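(* Consider the $K$-armed bandit problem with normal rewards having unknown and possibly unequal variances, where either $K=N^{\zeta+o(1)}\to\infty$ for some $0<\zeta<1$, or $K$ is fixed (and $\zeta=0$), as $N\to\infty$. If a bandit algorithm is uniformly good, then for all $\Delta_K\to0$ at a sub-polynomial rate, $$\liminf_{N\to\infty}\Big[\inf_{\boldsymbol{\theta}\in\Theta_2(\Delta_K)}\frac{R_N(\boldsymbol{\theta})}{r(\boldsymbol{\theta})\log N}\Big]\ \ge\ 1-\zeta .$$
   Context: Setting: there are $K=K(N)$ arms and a total of $N$ rewards is to be collected. The rewards $X_{k1},X_{k2},\ldots$ of arm $k$ are i.i.d. $N(\mu_k,\sigma_k^2)$, independent across arms; $\theta_k=(\mu_k,\sigma_k^2)$ with $\sigma_k^2>0$, and $\boldsymbol{\theta}=\boldsymbol{\theta}_K=(\theta_1,\ldots,\theta_K)$ is unknown. A bandit algorithm chooses sequentially, for each $N$ (with $K=K(N)$), the arm from which the next reward is drawn, on the basis of past choices and observed rewards (possibly with independent randomization). $N_k$ is the number of rewards drawn from arm $k$ among the $N$ total rewards, $E_{\boldsymbol{\theta}}$ denotes expectation under $\boldsymbol{\theta}$, $\boldsymbol{\mu}=(\mu_1,\ldots,\mu_K)$ and $\mu_*=\max_k\mu_k$. Regret: $R_N(\boldsymbol{\theta})=\sum_{k=1}^K(\mu_*-\mu_k)E_{\boldsymbol{\theta}}N_k$. Let $M(z)=\frac12\log(1+z^2)$, $r(\boldsymbol{\theta})=\sum_{k:\mu_k<\mu_*}\frac{\mu_*-\mu_k}{M\left(\frac{\mu_*-\mu_k}{\sigma_k}\right)}$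 and $J(\boldsymbol{\mu})=\#\{k:\mu_k<\mu_*\}$. $(\Delta_K)$ is a sequence of positive numbers indexed by the number of arms $K$ (so it is a constant as $N\to\infty$ when $K$ is fixed); $\Delta_K\to0$ at a sub-polynomial rate means that, as $K\to\infty$, $\Delta_K\to0$ and $\Delta_K K^{\epsilon}\to\infty$ for all $\epsilon>0$. $$\Theta_2(\Delta_K)=\Big\{\boldsymbol{\theta}_K:\ \max_{k:\mu_k<\mu_*}\mu_k\le\mu_*-\Delta_K,\ \max_k|\mu_k|\le\Delta_K^{-1},\ \Delta_K\le\sigma_k\le\Delta_K^{-1}\text{ for all }k,\ J(\boldsymbol{\mu})\ge\Delta_K K\Big\}.$$ Uniformly good: for any $\Delta_K\to0$ at a sub-polynomial rate, $\sup_{\boldsymbol{\theta}\in\Theta_2(\Delta_K)}R_N(\boldsymbol{\theta})=o(KN^{\epsilon})$ as $N\to\infty$ for all $\epsilon>0$. (Suprema over an empty parameter set are taken as $0$, infima as $+\infty$.) *)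

(* Defs.v *)
From HB Require Import structures.
From mathcomp Require Import all_boot all_order all_algebra.
From mathcomp Require Import all_classical all_reals all_analysis.

Set Implicit Arguments.
Unset Strict Implicit.
Unset Printing Implicit Defensive.
Import Order.TTheory GRing.Theory Num.Theory.
Import numFieldNormedType.Exports.
Local Open Scope classical_set_scope.
Local Open Scope ring_scope.

(* The arm parameters theta_k = (mu_k, sigma_k^2), sigma_k^2 > 0, are recorded
   through the mean and the (positive) standard deviation. *)
Record params (R : realType) (K : nat) := Params {
  mean : 'I_K -> R;
  sd : 'I_K -> R;
  sd_gt0 : forall k, 0 < sd k }.

(* A bandit algorithm.  [alg_choice n a v y] is the arm from which reward
   number n + 1 is drawn, when the arms a_0, ..., a_(n-1) were chosen so far,
   with observed rewards y_0, ..., y_(n-1), and v is the value of the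
   independent randomization, which lives in an arbitrary probability space. *)
Record algorithm (R : realType) (K : nat) := Algorithm {
  alg_disp : measure_display;
  alg_rand : measurableType alg_disp;
  alg_law : probability alg_rand R;
  alg_choice : forall n : nat,
    n.-tuple 'I_K -> alg_rand -> n.-tuple R -> 'I_K;
  alg_choice_measurable : forall (n : nat) (a : n.-tuple 'I_K) (k : 'I_K),
    measurable [set p : alg_rand * n.-tuple R | alg_choice a p.1 p.2 = k] }.

(* A statistical model for A : one measurable space carrying the rewards and
   the randomization, with a probability measure P_theta for each theta.
   [reward k j] is the (j+1)-st reward drawn from arm k.  Since the sets B k j
   and C may be full, [model_independent] is the mutual independence of the
   whole family formed by all the rewards and the randomization. *)
Record bandit_model (R : realType) (K : nat) (A : algorithm R K) :=
  BanditModel {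
  model_disp : measure_display;
  outcome : measurableType model_disp;
  reward : 'I_K -> nat -> outcome -> R;
  rand : outcome -> alg_rand A;
  prob : params R K -> probability outcome R;
  reward_measurable : forall k j, measurable_fun setT (reward k j);
  rand_measurable : measurable_fun setT rand;
  reward_law : forall theta k j (B : set R), measurable B ->
    prob theta (reward k j @^-1` B) =
    normal_prob (mean theta k) (sd theta k) B;
  rand_law : forall theta (C : set (alg_rand A)), measurable C ->
    prob theta (rand @^-1` C) = alg_law A C;
  model_independent : forall theta (n : nat)
      (B : 'I_K -> 'I_n -> set R) (C : set (alg_rand A)),
    (forall k j, measurable (B k j)) -> measurable C ->
    prob theta [set w | C (rand w) /\ forall k j, B k j (reward k j w)] =
    (prob theta (rand @^-1` C) *
     \prod_(k < K) \prod_(j < n) prob theta (reward k j @^-1` B k j))%E }.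

Section bandit.
Variables (R : realType) (K : nat).
Implicit Types (A : algorithm R K) (theta : params R K) (Delta : R).

(* The arms and rewards of the first n draws, when x k j is the (j+1)-st
   reward of arm k : a draw from arm k yields the first reward of that arm not
   collected yet. *)
Fixpoint history A (v : alg_rand A) (x : 'I_K -> nat -> R) (n : nat) :
    n.-tuple 'I_K * n.-tuple R :=
  if n is m.+1 then
    let: (a, y) := history v x m in
    let k := alg_choice a v y in
    ([tuple of rcons a k], [tuple of rcons y (x k (count_mem k a))])
  else ([tuple], [tuple]).

Definition num_draws A (Q : bandit_model A) (N : nat) (k : 'I_K)
    (w : outcome Q) : nat :=
  count_mem k (history (rand w) (fun i j => reward i j w) N).1.

(* supremum of a finite set, hence a maximum (K > 0) *)
Definition best_mean theta : R := sup (range (mean theta)).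

Definition regret A (Q : bandit_model A) (N : nat) theta : \bar R :=
  (\sum_(k < K) (best_mean theta - mean theta k)%:E *
     'E_(prob Q theta)[fun w => (num_draws N k w)%:R])%E.

Definition info (z : R) : R := 2^-1 * ln (1 + z ^+ 2).

Definition lower_coef theta : R :=
  \sum_(k < K | mean theta k < best_mean theta)
    (best_mean theta - mean theta k) /
    info ((best_mean theta - mean theta k) / sd theta k).

Definition num_inferior theta : nat :=
  #|[set k | mean theta k < best_mean theta]|.

Definition Theta2 Delta : set (params R K) :=
  [set theta |
    [/\ forall k, mean theta k < best_mean theta ->
          mean theta k <= best_mean theta - Delta,
        forall k, `|mean theta k| <= Delta^-1,
        forall k, Delta <= sd theta k <= Delta^-1 &
        Delta * K%:R <= (num_inferior theta)%:R]].

End bandit.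

Definition subpolynomial (R : realType) (Delta : nat -> R) : Prop :=
  [/\ forall K, 0 < Delta K,
      Delta K @[K --> \oo] --> 0 &
      forall eps : R, 0 < eps ->
        Delta K * K%:R `^ eps @[K --> \oo] --> +oo].

(* Regrets are nonnegative, so the maximum with 0 only sets the supremum over
   an empty parameter set to 0; the bound for all eta > 0 is o(K N^eps). *)
Definition uniformly_good (R : realType) (K : nat -> nat)
    (A : forall N, algorithm R (K N)) (Q : forall N, bandit_model (A N)) :=
  forall Delta : nat -> R, subpolynomial Delta ->
  forall eps : R, 0 < eps -> forall eta : R, 0 < eta ->
  \forall N \near \oo,
    (maxe 0 (ereal_sup [set regret (Q N) N theta |
                         theta in Theta2 (Delta (K N))])
     <= (eta * ((K N)%:R * N%:R `^ eps))%:E)%E.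

(* K = N ^ (zeta + o(1)) -> oo with 0 < zeta < 1, or K fixed and zeta = 0. *)
Definition arms_regime (R : realType) (K : nat -> nat) (zeta : R) : Prop :=
  [/\ 0 < zeta < 1,
      K N @[N --> \oo] --> \oo &
      exists2 e : nat -> R, e N @[N --> \oo] --> 0 &
        \forall N \near \oo, (K N)%:R = N%:R `^ (zeta + e N)]
  \/ (zeta = 0 /\ exists K0 : nat, forall N, K N = K0).

(* Main.v *)
(* By Gibbs' variational inequality, applied to the change of measure from theta
   to a model theta' in which only arm k is modified, E_theta N_k times the
   Kullback-Leibler divergence between the two laws of arm k is at least
   c E_theta (1 - N_k / N) - 1 as soon as e^c E_theta' (1 - N_k / N) <= 1.
   Take theta'_k with mean mu' just above mu_* and variance
   sigma_k^2 + (mu' - mu_k)^2; the divergence is then M((mu' - mu_k) / sigma_k),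
   and theta' lies in a class Theta_2(eta Delta / 4), so that uniform goodness
   allows c close to (1 - zeta) log N.  Uniform goodness at theta itself makes
   E_theta N_k / N negligible. *)

(* For a given mean mu', the divergence from N(mu_k, sigma_k^2) to N(mu', v) is least at v =
   sigma_k^2 + (mu' - mu_k)^2, and M is that least value. The same choice makes the log-likelihood
   ratio a constant minus a square. The variational inequality can then be arranged with nonnegative
   terms on both sides, and no integrability of the ratio has to be established. The measures
   P_theta and P_theta' live on an abstract space and are related only through the laws of the
   rewards and of the randomization. The likelihood ratio is therefore shown to be a density only on
   events determined by the randomization, the rewards of the other arms and the first m rewards of
   arm k. The event N_k = m is of this kind, and summing over m gives the ratio stopped at N_k. The
   margin of mu' over mu_* is eta Delta. Gaps are at least Delta, so it costs at most a factor (1 +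
   eta)^2 in the divergence, while every draw from another arm costs at least eta Delta under
   theta'. *)
From HB Require Import structures.
Require Import Defs.
From mathcomp Require Import all_boot all_order all_algebra.
From mathcomp Require Import all_classical all_reals all_analysis.
From mathcomp Require Import measurable_realfun ring lra.
Import Order.TTheory GRing.Theory Num.Theory.
Import numFieldNormedType.Exports.
Local Open Scope classical_set_scope.
Local Open Scope ring_scope.

Set Implicit Arguments.
Unset Strict Implicit.
Unset Printing Implicit Defensive.

(** * Densities and independence *)

Section density.
Context d (T : measurableType d) (R : realType).
Variables (mu : {measure set T -> \bar R}) (f : T -> R).
Hypotheses (f0 : forall x, 0 <= f x) (mf : measurable_fun setT f).
Local Open Scope ereal_scope.

Lemma density_measure_exists : exists nu : {measure set T -> \bar R},
  forall A, measurable A -> nu A = \int[mu]_(x in A) (f x)%:E.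
Proof.
pose dens (A : set T) := \int[mu]_(x in A) (f x)%:E.
have d0 : dens set0 = 0 by rewrite /dens integral_set0.
have d1 A : 0 <= dens A by apply: integral_ge0 => x _; rewrite lee_fin.
have d2 : semi_sigma_additive dens.
  move=> F mF tF mUF; rewrite /dens ge0_integral_bigcup//=.
  - by apply: is_cvg_ereal_nneg_natsum_cond => // n _ _; exact: d1.
  - exact/measurable_funTS/measurable_EFinP.
  - by move=> x _; rewrite lee_fin.
pose nu : {measure set T -> \bar R} :=
  HB.pack dens (isMeasure.Build _ _ _ dens d0 d1 d2).
by exists nu.
Qed.

Import HBNNSimple.

(** True by the hypothesis on [nu] for indicators, hence for simple functions by linearity; monotone
    convergence along [nnsfun_approx] gives the rest. *)
Lemma ge0_integral_density (nu : {measure set T -> \bar R}) (D : set T)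
    (g : T -> \bar R) :
  (forall A, measurable A -> nu A = \int[mu]_(x in A) (f x)%:E) ->
  measurable D -> measurable_fun D g -> (forall x, D x -> 0 <= g x) ->
  \int[nu]_(x in D) g x = \int[mu]_(x in D) (g x * (f x)%:E).
Proof.
move=> nuE mD mg g0; pose h := nnsfun_approx mD mg.
have mfD : measurable_fun D (EFin \o f) by exact/measurable_funTS/measurable_EFinP.
have mhD n : measurable_fun D (EFin \o h n).
  exact/measurable_funTS/measurable_EFinP.
have hg x : D x -> (EFin \o h n) x @[n --> \oo] --> g x.
  by move=> Dx; apply: cvg_nnsfun_approx => // y /= Dy; exact: g0.
transitivity (limn (fun n => \int[nu]_(x in D) (h n x)%:E)).
  rewrite -monotone_convergence//.
  - by apply: eq_integral => x /[!inE] Dx; apply/esym/cvg_lim => //; exact: hg.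
  - by move=> n x _; rewrite lee_fin.
  - by move=> x _ m n mn; rewrite lee_fin; exact/lefP/nd_nnsfun_approx.
transitivity (limn (fun n => \int[mu]_(x in D) ((h n x)%:E * (f x)%:E))); last first.
  rewrite -monotone_convergence//.
  - apply: eq_integral => x /[!inE] Dx; apply/cvg_lim => //.
    by apply: cvgeZr => //; exact: hg.
  - by move=> n; exact: emeasurable_funM (mhD n) mfD.
  - by move=> n x _; rewrite mule_ge0// lee_fin.
  - move=> x _ m n mn; rewrite lee_wpmul2r ?lee_fin//.
    exact/lefP/nd_nnsfun_approx.
apply/congr_lim/funext => n /=.
have mr r : measurable_fun D (fun x => (r * \1_(h n @^-1` [set r]) x)%:E).
  by apply/measurable_EFinP/measurable_funTS; exact: measurable_funM.
under eq_integral do rewrite fimfunE -fsumEFin//.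
rewrite ge0_integral_fsum//; last by move=> r x _; exact: nnfun_muleindic_ge0.
under [RHS]eq_integral => x xE.
  rewrite fimfunE -fsumEFin// ge0_mule_fsuml; last first.
    by move=> r; exact: nnfun_muleindic_ge0.
  over.
rewrite ge0_integral_fsum//; last 2 first.
  - by move=> r; exact: emeasurable_funM (mr r) mfD.
  - by move=> r x _; apply: mule_ge0; rewrite ?lee_fin//; exact: nnfun_muleindic_ge0.
apply: eq_fsbigr => r; rewrite inE => -[t _ <-].
rewrite integralZl_indic_nnsfun//.
under [RHS]eq_integral do rewrite EFinM -muleA.
rewrite ge0_integralZl//; last 3 first.
- apply: emeasurable_funM => //; exact/measurable_funTS/measurable_EFinP.
- by move=> x _; rewrite mule_ge0 ?lee_fin.
- by rewrite lee_fin.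
congr (_ * _); rewrite integral_indic// nuE; last exact: measurableI.
under [RHS]eq_integral do rewrite muleC.
rewrite setIC integral_mkcondr; apply: eq_integral => x _.
by rewrite epatch_indic.
Qed.

End density.

Lemma ge0_integral_mrestr d (T : measurableType d) (R : realType)
    (mu : {measure set T -> \bar R}) (D : set T) (mD : measurable D)
    (g : T -> \bar R) :
  measurable_fun setT g -> (forall x, (0 <= g x)%E) ->
  (\int[mrestr mu mD]_x g x = \int[mu]_(x in D) g x)%E.
Proof.
move=> mg g0.
rewrite (@ge0_integral_density _ _ _ mu (\1_D) _ _ (mrestr mu mD))//; last first.
  by move=> A mA; rewrite integral_indic// /mrestr setIC.
by rewrite [RHS]integral_mkcond; apply: eq_integral => x _; rewrite epatch_indic.
Qed.

(** The hypothesis says that the law of [X] on [D] is [c] times [rho], so this is a change of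
    variables. It serves twice, with [X] a reward that [D] does not involve: in the change of
    measure and in Wald's identity. *)
Lemma ge0_integral_indep d (T : measurableType d) d' (U : measurableType d')
    (R : realType) (mu : {measure set T -> \bar R}) (rho : {measure set U -> \bar R})
    (X : T -> U) (D : set T) (c : {nonneg R}) (g : U -> \bar R) :
  measurable_fun setT X -> measurable D ->
  (forall B, measurable B -> mu (D `&` X @^-1` B) = c%:num%:E * rho B)%E ->
  measurable_fun setT g -> (forall x, (0 <= g x)%E) ->
  (\int[mu]_(x in D) g (X x) = c%:num%:E * \int[rho]_x g x)%E.
Proof.
move=> mX mD muE mg g0.
rewrite -(@ge0_integral_mscale _ _ _ rho setT)//.
pose Y : {mfun T >-> U} := HB.pack X (isMeasurableFun.Build _ _ _ _ X mX).
rewrite (@eq_measure_integral _ _ _ setT (pushforward (mrestr mu mD) Y)); last first.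
  move=> A mA _; change ((c%:num%:E * rho A)%E = mu (X @^-1` A `&` D)).
  by rewrite setIC muE.
rewrite (@ge0_integral_pushforward _ _ _ _ _ Y)//.
rewrite preimage_setT ge0_integral_mrestr//.
- by apply: measurableT_comp.
- by move=> x; exact: g0.
Qed.

(** * Likelihood ratios of normal laws *)

Section normal_tilt.
Context (R : realType).
Implicit Types (m s d t x : R).

Lemma normal_peakE s : 0 < s -> normal_peak s = s^-1 * normal_peak 1.
Proof.
move=> s0; rewrite /normal_peak -invfM; congr (_^-1).
by rewrite -mulrnAr sqrtrM ?sqr_ge0// sqrtr_sqr gtr0_norm// expr1n mul1r.
Qed.

Lemma normal_pdf_gt0E m s x : 0 < s ->
  normal_pdf m s x = s^-1 * normal_peak 1 * expR (- (x - m) ^+ 2 / (s ^+ 2 *+ 2)).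
Proof. by move=> s0; rewrite normal_pdfE ?gt_eqF// normal_peakE. Qed.

(* The log-likelihood ratio of N(m, s^2) against N(m + d, s^2 + d^2) is
   [llr_max s d - llr_gap m s d x]: the choice of the second variance makes the
   quadratic part a perfect square, so that every integral below has a
   nonnegative integrand. *)
Definition llr_gap m s d x : R :=
  (s + d * (x - m) / s) ^+ 2 / ((s ^+ 2 + d ^+ 2) *+ 2).

Definition llr_max s d : R := info (d / s) + 2^-1.

Lemma llr_gap_ge0 m s d x : 0 <= llr_gap m s d x.
Proof. by rewrite mulr_ge0 ?sqr_ge0// invr_ge0 mulrn_wge0// addr_ge0 ?sqr_ge0. Qed.

Lemma measurable_llr_gap m s d : measurable_fun setT (llr_gap m s d).
Proof.
apply: measurable_funM => //; apply: measurable_funX.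
apply: measurable_funD => //; apply: measurable_funM => //.
by apply: measurable_funM => //; exact: measurable_funB.
Qed.

Lemma expR_info s d : 0 < s -> expR (info (d / s)) = Num.sqrt (s ^+ 2 + d ^+ 2) / s.
Proof.
move=> s0; apply/eqP; rewrite -(@eqrXn2 _ 2)//; last first.
- by rewrite divr_ge0 ?sqrtr_ge0// ltW.
rewrite -expRM_natl /info mulrA divff// mul1r lnK; last first.
  by rewrite posrE ltr_pwDl// sqr_ge0.
rewrite !exprMn sqr_sqrtr ?addr_ge0 ?sqr_ge0//; apply/eqP; field.
by rewrite gt_eqF.
Qed.

Lemma normal_pdf_llr_gap m s d x : 0 < s ->
  normal_pdf (m + d) (Num.sqrt (s ^+ 2 + d ^+ 2)) x =
  normal_pdf m s x * expR (llr_gap m s d x - llr_max s d).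
Proof.
move=> s0; have V0 : 0 < s ^+ 2 + d ^+ 2 by rewrite ltr_pwDl ?exprn_gt0// sqr_ge0.
rewrite !normal_pdf_gt0E ?sqrtr_gt0// sqr_sqrtr ?ltW//.
have -> : (Num.sqrt (s ^+ 2 + d ^+ 2))^-1 = s^-1 * expR (- info (d / s)).
  rewrite expRN expR_info//; field.
  by rewrite ?gt_eqF// ?sqrtr_gt0//.
rewrite -!mulrA; congr (_ * _); rewrite mulrCA; congr (_ * _).
rewrite -!expRD; congr expR; rewrite /llr_max /llr_gap.
field.
by rewrite !gt_eqF.
Qed.

(* Completing the square turns the integrand into a multiple of another normal
   density; this gives the second moment below without differentiating. *)
Lemma integral_llr_gap_tilt m s d t : 0 < s -> 0 < t ->
  (\int[normal_prob m s]_x (expR (- (t * llr_gap m s d x)))%:E <=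
   (expR (- (t / (1 + t) / 2)))%:E)%E.
Proof.
move=> s0 t0; have V0 : 0 < s ^+ 2 + d ^+ 2 by rewrite ltr_pwDl ?exprn_gt0// sqr_ge0.
set V := s ^+ 2 + d ^+ 2 in V0 *.
have U0 : 0 < V + t * d ^+ 2 by rewrite ltr_pwDl// mulr_ge0 ?sqr_ge0// ltW.
set U := V + t * d ^+ 2 in U0 *.
(* In the product of the exponential and the density, the coefficient of [x ^+ 2] is that of a
   normal density of standard deviation [s / w]; completing the square moves the mean by
   [- t * d * s ^+ 2 / U] and leaves the constant [C]. *)
pose w := Num.sqrt (U / V).
have w0 : 0 < w by rewrite sqrtr_gt0 divr_gt0.
have w2 : w ^+ 2 = U / V by rewrite sqr_sqrtr// ltW// divr_gt0.
pose C := w^-1 * expR (- (t * s ^+ 2) / (U *+ 2)).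
have C0 : 0 <= C by rewrite mulr_ge0 ?invr_ge0 ?expR_ge0// ltW.
rewrite (@ge0_integral_density _ _ _ lebesgue_measure (normal_pdf m s))//; last 3 first.
- exact: normal_pdf_ge0.
- exact: measurable_normal_pdf.
- apply/measurable_EFinP; apply: measurableT_comp => //; apply: measurableT_comp => //.
  by apply: measurable_funM => //; exact: measurable_llr_gap.
have -> : (\int[lebesgue_measure]_x
    ((expR (- (t * llr_gap m s d x)))%:E * (normal_pdf m s x)%:E) =
    \int[lebesgue_measure]_x (C%:E *
      (normal_pdf (m - t * d * s ^+ 2 / U) (s / w) x)%:E))%E.
  apply: eq_integral => x _; rewrite -!EFinM; congr EFin.
  rewrite !normal_pdf_gt0E ?divr_gt0// /C.
  have -> : expR (- (t * llr_gap m s d x)) *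
     (s^-1 * normal_peak 1 * expR (- (x - m) ^+ 2 / (s ^+ 2 *+ 2))) =
     (s^-1 * normal_peak 1) *
     expR (- (t * llr_gap m s d x) + - (x - m) ^+ 2 / (s ^+ 2 *+ 2)).
    by rewrite expRD; ring.
  have -> : w^-1 * expR (- (t * s ^+ 2) / (U *+ 2)) *
   ((s / w)^-1 * normal_peak 1 *
    expR (- (x - (m - t * d * s ^+ 2 / U)) ^+ 2 / ((s / w) ^+ 2 *+ 2))) =
     (s^-1 * normal_peak 1) *
     expR (- (t * s ^+ 2) / (U *+ 2) +
       - (x - (m - t * d * s ^+ 2 / U)) ^+ 2 / ((s / w) ^+ 2 *+ 2)).
    rewrite expRD; field.
    by rewrite !gt_eqF.
  congr (_ * expR _); rewrite exprMn exprVn w2 /llr_gap -/V /U.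
  rewrite /U in U0; rewrite /V in V0 U0 *; field.
  by rewrite !gt_eqF.
rewrite ge0_integralZl//; last 2 first.
- by apply/measurable_EFinP; exact: measurable_normal_pdf.
- by move=> x _; rewrite lee_fin normal_pdf_ge0.
rewrite integral_normal_pdf mule1 lee_fin.
(* With [1 + z <= expR z] at [z = V / U - 1], the exponents add up to [- t V / (2 U)], and
   [U <= (1 + t) V] because [d ^+ 2 <= V]. *)
have wV : w^-1 <= expR ((V / U - 1) / 2).
  rewrite -(@ler_pXn2r _ 2)// ?nnegrE ?expR_ge0 ?invr_ge0 ?(ltW w0)//.
  rewrite -expRM_natl exprVn w2 invf_div.
  rewrite (_ : 2 * _ = V / U - 1); last by field; rewrite gt_eqF.
  by apply: le_trans (expR_ge1Dx _); rewrite addrC subrK.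
apply: (le_trans (ler_wpM2r (expR_ge0 _) wV)); rewrite -expRD ler_expR.
have -> : (V / U - 1) / 2 + - (t * s ^+ 2) / (U *+ 2) = - (t * (V / U) / 2).
  by rewrite /U /V in U0 V0 *; field; rewrite gt_eqF.
have t1 : 0 < 1 + t by rewrite addr_gt0.
rewrite lerN2 ler_pM2r// ler_pM2l// ler_pdivlMr// mulrC ler_pdivrMr//.
rewrite /U mulrDr mulr1 lerD2l mulrC ler_pM2r// /V lerDr.
by rewrite exprn_ge0// ltW.
Qed.

(** With [x = m + s z], z standard normal, the numerator is [(s + d z) ^+ 2], of mean
    [s ^+ 2 + d ^+ 2]: hence the 1/2, and [llr_max s d - 2^-1 = info (d / s)] is the divergence. The
    proof integrates [1 - t q <= expR (- t q)], where q is the gap, bounds the right side by the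
    previous lemma, and lets t tend to 0 in [1 / (2 + 3 t) <= r]. *)
Lemma integral_llr_gap_ge m s d : 0 < s ->
  ((2^-1)%:E <= \int[normal_prob m s]_x (llr_gap m s d x)%:E)%E.
Proof.
move=> s0; set I := (X in (_ <= X)%E).
have I0 : (0 <= I)%E by apply: integral_ge0 => x _; rewrite lee_fin llr_gap_ge0.
case IE : I I0 => [r||]// r0; last by rewrite leey.
have mE : measurable_fun setT (EFin \o llr_gap m s d).
  by apply/measurable_EFinP; exact: measurable_llr_gap.
have key t : 0 < t -> 1 / (2 + 3 * t) <= r.
  move=> t0; have : (1 <= (expR (- (t / (1 + t) / 2)))%:E + (t * r)%:E)%E.
    rewrite [(t * r)%:E]EFinM -IE /I.
    apply: le_trans (leeD2r _ (integral_llr_gap_tilt m d s0 t0)).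
    rewrite -ge0_integralZl_EFin ?(ltW t0)//; last first.
      by move=> x _; rewrite lee_fin llr_gap_ge0.
    have m1 : measurable_fun setT
        (fun x => (expR (- (t * llr_gap m s d x)))%:E).
      apply/measurable_EFinP; apply: measurableT_comp => //; apply: measurableT_comp => //.
      by apply: measurable_funM => //; exact: measurable_llr_gap.
    have m2 : measurable_fun setT (fun x => t%:E * (llr_gap m s d x)%:E)%E.
      exact: measurable_funeM.
    have p2 x : (0 <= t%:E * (llr_gap m s d x)%:E)%E.
      by rewrite mule_ge0 ?lee_fin ?llr_gap_ge0// ltW.
    rewrite -ge0_integralD//.
    have E1 : (\int[normal_prob m s]_x (cst 1 x) = 1)%E.
      by rewrite integral_cst// mul1e; exact: (@probability_setT _ _ _ (normal_prob m s)).
    rewrite -[X in (X <= _)%E]E1.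
    apply: ge0_le_integral => //.
    - exact: emeasurable_funD.
    - move=> x _; rewrite -EFinM -EFinD lee_fin.
      by have := expR_ge1Dx (- (t * llr_gap m s d x)); lra.
  rewrite -EFinD lee_fin => h.
  pose z := t / (1 + t) / 2.
  have z0 : 0 < z by rewrite !divr_gt0// addr_gt0.
  have : expR (- z) <= (1 + z)^-1.
    by rewrite expRN lef_pV2 ?posrE ?expR_gt0 ?addr_gt0// expR_ge1Dx.
  rewrite -/z in h => h2.
  have : z / (1 + z) <= t * r.
    have -> : z / (1 + z) = 1 - (1 + z)^-1 by field; rewrite gt_eqF// addr_gt0.
    by lra.
  have -> : z / (1 + z) = t * (1 / (2 + 3 * t)).
    by rewrite /z; field; rewrite !gt_eqF//; lra.
  by rewrite ler_pM2l.
rewrite lee_fin; apply/ler_addgt0Pr => e e0.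
apply: (@le_trans _ _ (1 / (2 + 3 * e) + e)).
  rewrite -subr_ge0.
  have -> : 1 / (2 + 3 * e) + e - 2^-1 = e * (1 + 6 * e) / ((2 + 3 * e) * 2).
    by field; rewrite gt_eqF//; lra.
  by rewrite divr_ge0 ?mulr_ge0//; lra.
by rewrite lerD2r key.
Qed.
End normal_tilt.

(** * Independence of future rewards *)

(** Leaving a 1 in place of the isolated factor makes the remainders of two products that differ
    only at [(k, l)] directly comparable. *)
Lemma prode_isolate (R : realType) (m n : nat) (F : 'I_m -> 'I_n -> \bar R) k l :
  (\prod_(i < m) \prod_(j < n) F i j =
   F k l * \prod_(i < m) \prod_(j < n)
     (if (i == k) && (j == l) then 1 else F i j))%E.
Proof.
rewrite !pair_big (bigD1 (k, l))//= [in RHS](bigD1 (k, l))//= !eqxx mul1e.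
congr (_ * _)%E; apply: eq_bigr => -[i j] /=; rewrite xpair_eqE => /negbTE.
by move=> ->.
Qed.

Section rectangles.
Context (R : realType) (K : nat) (A : algorithm R K) (Q : bandit_model A).
Variables (N : nat).
Notation X := (fun i j => @reward R K A Q i j).

Definition rect (B : 'I_K -> 'I_N -> set R) (C : set (alg_rand A)) :
    set (outcome Q) :=
  [set w | C (rand w) /\ forall i j, B i j (reward i j w)].

(* [rects k m] generates the information carried by the randomization, the
   rewards of the arms other than k and the first m rewards of arm k. *)
Definition rects (k : 'I_K) (m : nat) : set (set (outcome Q)) :=
  [set S | exists B C, [/\ forall i j, measurable (B i j), measurable C,
     forall j : 'I_N, (m <= j)%N -> B k j = setT & S = rect B C]].

Lemma measurable_rect B C : (forall i j, measurable (B i j)) -> measurable C ->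
  measurable (rect B C).
Proof.
move=> mB mC.
have -> : rect B C = rand (b:=Q) @^-1` C `&`
    \bigcap_(i in [set: 'I_K]) \bigcap_(j in [set: 'I_N]) (X i j @^-1` B i j).
  apply/seteqP; split => w /=; first by move=> [? BX]; split => // i _ j _; exact: BX.
  by move=> [? BX]; split => // i j; exact: BX.
apply: measurableI.
  by rewrite -[X in measurable X]setTI; exact: (@rand_measurable _ _ _ Q).
apply: fin_bigcap_measurable => // i _; apply: fin_bigcap_measurable => // j _.
by rewrite -[X in measurable X]setTI; exact: (@reward_measurable _ _ _ Q).
Qed.

Lemma rects_measurable k m : rects k m `<=` measurable.
Proof. by move=> _ [B [C [mB mC _ ->]]]; exact: measurable_rect. Qed.

Lemma g_rects_measurable k m : <<s rects k m >> `<=` measurable.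
Proof.
by apply: smallest_sub; [exact: sigma_algebra_measurable | exact: rects_measurable].
Qed.

Lemma rects_setI k m : setI_closed (rects k m).
Proof.
move=> _ _ [B [C [mB mC BT ->]]] [B' [C' [mB' mC' BT' ->]]].
exists (fun i j => B i j `&` B' i j), (C `&` C'); split.
- by move=> i j; exact: measurableI.
- exact: measurableI.
- by move=> j mj; rewrite BT// BT'// setTI.
- apply/seteqP; split => w /=.
    move=> [[Cw BX] [Cw' BX']]; split; first by split.
    by move=> i j; split; [exact: BX | exact: BX'].
  by move=> [[? ?] BX]; split; split=> // i j; case: (BX i j).
Qed.

Lemma rects_setT k m : rects k m setT.
Proof.
exists (fun _ _ => setT), setT; split => //.
by apply/seteqP; split.
Qed.

Lemma sub_rects k m n : (m <= n)%N -> rects k m `<=` rects k n.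
Proof.
move=> mn _ [B [C [mB mC BT ->]]]; exists B, C; split => // j nj.
by apply: BT; exact: leq_trans nj.
Qed.

Lemma sub_g_rects k m n : (m <= n)%N -> <<s rects k m >> `<=` <<s rects k n >>.
Proof. by move=> mn; apply: sub_smallest2r => //; exact: sub_rects. Qed.

Lemma prob_rect theta B C : (forall i j, measurable (B i j)) -> measurable C ->
  prob Q theta (rect B C) =
  (alg_law A C * \prod_(i < K) \prod_(j < N)
     normal_prob (mean theta i) (sd theta i) (B i j))%E.
Proof.
move=> mB mC; rewrite model_independent// rand_law//; congr (_ * _)%E.
by apply: eq_bigr => i _; apply: eq_bigr => j _; rewrite reward_law.
Qed.

Lemma g_rects_unique k m (m1 m2 : {measure set (outcome Q) -> \bar R}) :
  (m1 setT < +oo)%E ->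
  (forall S, rects k m S -> m1 S = m2 S) ->
  forall S, <<s rects k m >> S -> m1 S = m2 S.
Proof.
move=> fin eq12; apply: (g_sigma_algebra_measure_unique (rects k m) _ (fun=> setT)) => //.
- exact: rects_measurable.
- by move=> _; exact: rects_setT.
- by apply/seteqP; split => // x _; exists 0%N.
- exact: rects_setI.
Qed.

(** The factors may depend on [j] as well as on the arm, to cover the intermediate measures under
    which only the first rewards of arm k have changed law. *)
Definition product_law (nu : set (outcome Q) -> \bar R)
    (rho : 'I_K -> 'I_N -> set R -> \bar R) :=
  forall B C, (forall i j, measurable (B i j)) -> measurable C ->
  nu (rect B C) = (alg_law A C * \prod_(i < K) \prod_(j < N) rho i j (B i j))%E.

Lemma product_law_indep nu rho k j B C (B0 : set R) : product_law nu rho ->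
  rho k j setT = 1%E ->
  (forall i j, measurable (B i j)) -> measurable C -> measurable B0 ->
  B k j = setT ->
  (nu (rect B C `&` X k j @^-1` B0) = nu (rect B C) * rho k j B0)%E.
Proof.
move=> nuE rhoT mB mC mB0 BT.
pose B' i l := if (i == k) && (l == j) then B0 else B i l.
have -> : rect B C `&` X k j @^-1` B0 = rect B' C.
  apply/seteqP; split => w.
    move=> [[Cw BX] B0X]; split=> // i l; rewrite /B'.
    by case: ifPn => [/andP[/eqP -> /eqP ->]|_ ] //; exact: BX.
  move=> [Cw BX]; split; last first.
    by have := BX k j; rewrite /B' !eqxx.
  split=> // i l; have := BX i l; rewrite /B'.
  by case: ifPn => [/andP[/eqP -> /eqP ->]|_ ] //; rewrite BT.
rewrite !nuE//; last by move=> i l; rewrite /B'; case: ifP.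
rewrite (prode_isolate _ k j) [in RHS](prode_isolate _ k j) BT rhoT mul1e.
rewrite /B' !eqxx /= [RHS]muleAC -[RHS]muleA; congr (_ * (_ * _))%E.
apply: eq_bigr => i _; apply: eq_bigr => l _.
by case: (_ && _).
Qed.

Lemma measurable_reward_preimage k j (B : set R) :
  measurable B -> measurable (X k j @^-1` B).
Proof.
move=> mB; rewrite -[Y in measurable Y]setTI.
exact: (@reward_measurable _ _ _ Q).
Qed.

(** As functions of [D], both sides are finite measures that agree on the pi-system [rects k j],
    whose sets leave the reward [j] of arm k free. *)
Lemma reward_indep theta k (j : 'I_N) D (B : set R) :
  <<s rects k j >> D -> measurable B ->
  prob Q theta (D `&` X k j @^-1` B) =
  (prob Q theta D * normal_prob (mean theta k) (sd theta k) B)%E.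
Proof.
move=> sD mB.
have mXB := measurable_reward_preimage k j mB.
have rho0 : 0 <= fine (normal_prob (mean theta k) (sd theta k) B).
  by rewrite fine_ge0// measure_ge0.
have rhoK : ((fine (normal_prob (mean theta k) (sd theta k) B))%:E =
    normal_prob (mean theta k) (sd theta k) B)%E.
  rewrite fineK//.
  exact: (fin_num_measure (normal_prob (mean theta k) (sd theta k))).
pose m1 : {measure set _ -> \bar R} := mrestr (prob Q theta) mXB.
pose m2 : {measure set _ -> \bar R} := mscale (NngNum rho0) (prob Q theta).
suff eqD : m1 D = m2 D by rewrite muleC -rhoK; exact: eqD.
apply: g_rects_unique sD.
  apply: (@le_lt_trans _ _ 1%E); last exact: ltry.
  by apply: probability_le1; rewrite setTI.
move=> _ [B' [C [mB' mC BT ->]]].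
transitivity (prob Q theta (rect B' C) *
    normal_prob (mean theta k) (sd theta k) B)%E.
  apply: (@product_law_indep _ (fun i j => normal_prob (mean theta i) (sd theta i))) => //.
  - by move=> *; exact: prob_rect.
  - exact: (@probability_setT _ _ _ (normal_prob (mean theta k) (sd theta k))).
  - exact: BT.
by rewrite muleC -rhoK.
Qed.

End rectangles.

(** * Change of measure *)

Section change_of_measure.
Context (R : realType) (K : nat) (A : algorithm R K) (Q : bandit_model A).
Variables (N : nat) (k : 'I_K) (theta theta' : params R K) (d : R).
Hypothesis mean_other : forall i, i != k -> mean theta' i = mean theta i.
Hypothesis sd_other : forall i, i != k -> sd theta' i = sd theta i.
Hypothesis mean_k : mean theta' k = mean theta k + d.
Hypothesis sd_k : sd theta' k = Num.sqrt (sd theta k ^+ 2 + d ^+ 2).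

Let X (i : 'I_K) (j : nat) : outcome Q -> R := reward i j.
Let P := prob Q theta.
Let q (x : R) : R := llr_gap (mean theta k) (sd theta k) d x.
Let b : R := llr_max (sd theta k) d.
Let rho i : set R -> \bar R := normal_prob (mean theta i) (sd theta i).
Let rho' : set R -> \bar R := normal_prob (mean theta' k) (sd theta' k).

Let rho_setT i : rho i setT = 1%E.
Proof. exact: (@probability_setT _ _ _ (normal_prob (mean theta i) (sd theta i))). Qed.

Let rho'_setT : rho' setT = 1%E.
Proof. exact: (@probability_setT _ _ _ (normal_prob (mean theta' k) (sd theta' k))). Qed.

(** The likelihood ratio of theta' against theta on the first [m] rewards of arm k. *)
Definition tilt (m : nat) (w : outcome Q) : R :=
  expR (\sum_(j < m) (q (X k j w) - b)).

Lemma measurable_tilt m : measurable_fun setT (tilt m).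
Proof.
apply: measurableT_comp => //; apply: measurable_sum => j.
apply: measurable_funB => //; apply: measurableT_comp; first exact: measurable_llr_gap.
exact: (@reward_measurable _ _ _ Q).
Qed.

Lemma integral_llr_gap_density B : measurable B ->
  (\int[normal_prob (mean theta k) (sd theta k)]_(x in B) (expR (q x - b))%:E =
   rho' B)%E.
Proof.
move=> mB.
rewrite (@ge0_integral_density _ _ _ lebesgue_measure
  (normal_pdf (mean theta k) (sd theta k)))//.
- rewrite /rho' /normal_prob; apply: eq_integral => x _.
  by rewrite mean_k sd_k normal_pdf_llr_gap ?sd_gt0// EFinM muleC.
- exact: normal_pdf_ge0.
- exact: measurable_normal_pdf.
- apply/measurable_EFinP/measurable_funTS; apply: measurableT_comp => //.
  by apply: measurable_funB => //; exact: measurable_llr_gap.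
Qed.

(** Induction on [m]: under the measure reached so far, reward [m] of arm k still has its original
    law and is independent of everything else, so one more factor of the ratio replaces that law
    alone. *)
Lemma tilted_law m : (m <= N)%N ->
  exists nu : {measure set (outcome Q) -> \bar R},
    (forall D, measurable D -> nu D = \int[P]_(w in D) (tilt m w)%:E)%E /\
    product_law (N := N) nu
      (fun i j => if (i == k) && (j < m)%N then rho' else rho i).
Proof.
elim: m => [_|m IH mN].
  exists P; split.
    move=> D mD; rewrite -[LHS]mul1e -integral_cst//; apply: eq_integral => w _.
    by rewrite /tilt big_ord0 expR0.
  move=> B C mB mC; apply: etrans (prob_rect Q theta mB mC) _; congr (_ * _)%E.
  by apply: eq_bigr => i _; apply: eq_bigr => j _; rewrite ltn0 andbF.
have [nu [nuE nuL]] := IH (ltnW mN).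
have [nu' nu'E] := density_measure_exists P (fun w => expR_ge0 _) (measurable_tilt m.+1).
exists nu'; split => //.
pose jm : 'I_N := Ordinal mN.
have mX : measurable_fun setT (X k m) by exact: (@reward_measurable _ _ _ Q).
move=> B C mB mC.
(* Freeing the coordinate [(k, m)] gives a rectangle independent of the reward whose law is about to
   change. *)
pose B1 i j := if (i == k) && (j == jm) then setT else B i j.
pose S' := rect (Q := Q) B1 C.
have mB1 i j : measurable (B1 i j) by rewrite /B1; case: ifP.
have mS' : measurable S' by exact: measurable_rect.
have mr : measurable_fun setT (fun x => (expR (q x - b))%:E).
  apply/measurable_EFinP; apply: measurableT_comp => //.
  by apply: measurable_funB => //; exact: measurable_llr_gap.
have SE : rect B C = S' `&` X k m @^-1` B k jm.
  apply/seteqP; split => w.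
    move=> [Cw BX]; split; last exact: (BX k jm).
    by split=> // i j; rewrite /B1; case: ifP.
  move=> [[Cw BX] Bk]; split=> // i j; have := BX i j; rewrite /B1.
  by case: ifPn => // /andP[/eqP -> /eqP ->].
have nuT : nu setT = 1%E.
  have -> : [set: outcome Q] = rect (fun (_ : 'I_K) (_ : 'I_N) => setT) setT.
    by apply/seteqP; split.
  rewrite nuL// probability_setT mul1e big1// => i _; rewrite big1// => j _.
  by case: ifP.
have nuS'fin : nu S' \is a fin_num.
  rewrite ge0_fin_numE ?measure_ge0//; apply: (@le_lt_trans _ _ 1%E); last exact: ltry.
  by rewrite -nuT; apply: le_measure; rewrite ?inE.
have c0 : 0 <= fine (nu S') by rewrite fine_ge0.
have -> : nu' (rect B C) = (nu S' * rho' (B k jm))%E.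
  rewrite nu'E; last exact: measurable_rect.
  transitivity (\int[nu]_(w in rect B C) (expR (q (X k m w) - b))%:E)%E.
    rewrite [RHS](@ge0_integral_density _ _ _ P (tilt m))//.
    - apply: eq_integral => w _; rewrite -EFinM /tilt big_ord_recr/= [in LHS]expRD.
      by rewrite [in RHS]mulrC.
    - by move=> w; exact: expR_ge0.
    - exact: measurable_tilt.
    - exact: measurable_rect.
    - by apply: measurable_funTS; exact: measurableT_comp mr mX.
  rewrite SE integral_mkcondr.
  transitivity (\int[nu]_(w in S') (((fun x => (expR (q x - b))%:E) \_ (B k jm)) (X k m w)))%E.
    by apply: eq_integral => w _; rewrite !patchE.
  rewrite (@ge0_integral_indep _ _ _ _ _ nu
    (normal_prob (mean theta k) (sd theta k)) (X k m) S' (NngNum c0))//.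
  - by rewrite /= fineK// -integral_mkcond (integral_llr_gap_density (mB k jm)).
  - move=> B0 mB0; rewrite /= fineK//.
    have := product_law_indep (k := k) (j := jm) nuL _ mB1 mC mB0.
    rewrite ltnn andbF; apply; first exact: rho_setT.
    by rewrite /B1 !eqxx.
  - apply/(measurable_restrictT _ _).1; first exact: (mB k jm).
    by apply: (measurable_funS measurableT) => //; exact: mr.
  - by move=> x; rewrite patchE; case: ifP; rewrite lee_fin ?expR_ge0.
rewrite nuL// (prode_isolate _ k jm) [in RHS](prode_isolate _ k jm).
rewrite /B1 !eqxx /= ltnn ltnSn rho_setT mul1e [LHS]muleAC -[LHS]muleA.
congr (_ * (_ * _))%E.
apply: eq_bigr => i _; apply: eq_bigr => j _.
case E : (_ && _) => //.
suff -> : (i == k) && (j < m.+1)%N = (i == k) && (j < m)%N by [].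
by move: E; case: (i == k) => //=; rewrite -val_eqE ltnS leq_eqVlt /= => ->.
Qed.

(** On a rectangle of [rects k m] the rewards of arm k from index [m] on are unconstrained, so their
    factors equal 1 under both laws, although only the first [m] laws were changed. *)
Lemma prob_tilt m D : (m <= N)%N -> <<s rects (Q := Q) N k m >> D ->
  prob Q theta' D = (\int[P]_(w in D) (tilt m w)%:E)%E.
Proof.
move=> mN sD; have [nu [nuE nuL]] := tilted_law mN.
rewrite -nuE; last exact: g_rects_measurable sD.
apply: g_rects_unique sD.
  by apply: (@le_lt_trans _ _ 1%E); [exact: probability_le1 | exact: ltry].
move=> _ [B [C [mB mC BT ->]]]; rewrite nuL//.
apply: etrans (prob_rect Q theta' mB mC) _; congr (_ * _)%E.
apply: eq_bigr => i _; apply: eq_bigr => j _.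
have [->|ik] := eqVneq i k; last by rewrite /= /rho mean_other// sd_other.
rewrite andTb; case: (ltnP j m) => [_|mj]; first by [].
rewrite BT// rho_setT; exact: rho'_setT.
Qed.

End change_of_measure.

(** * Numbers of draws as stopping times *)

Section stopping_time.
Context (R : realType) (K : nat) (A : algorithm R K) (Q : bandit_model A).
Variables (N : nat) (k : 'I_K) (m : nat).

Let F : measurableType (rects (Q := Q) N k m).-sigma :=
  g_sigma_algebraType (rects (Q := Q) N k m).

Lemma measurable_rand_past : measurable_fun setT (rand (b := Q) : F -> alg_rand A).
Proof.
move=> _ C mC; rewrite setTI; apply: sub_sigma_algebra.
exists (fun _ _ => setT), C; split => //.
by apply/seteqP; split => [w Cw|w []].
Qed.

Lemma measurable_reward_past i j : (j < N)%N -> (i == k -> (j < m)%N) ->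
  measurable_fun setT (reward (b := Q) i j : F -> R).
Proof.
move=> jN jm _ B mB; rewrite setTI; apply: sub_sigma_algebra.
exists (fun i' j' => if (i' == i) && (j' == j :> nat) then B else setT), setT; split => //.
- by move=> i' j'; case: ifP.
- move=> j' mj'; case: ifPn => // /andP[/eqP ki /eqP jj'].
  by move: jm; rewrite -ki eqxx => /(_ isT); rewrite -jj' ltnNge mj'.
- apply/seteqP; split => w.
    by move=> BX; split=> // i' j'; case: ifPn => // /andP[/eqP -> /eqP ->].
  by move=> [_ /(_ i (Ordinal jN))]; rewrite !eqxx.
Qed.

Notation hist w n := (history (rand (b := Q) w) (fun i j => reward i j w) n).

(** Once the arms [a] are fixed, the indices of the rewards read are fixed too, and those of arm k
    stay below [m]. The observed rewards are measurable for the past only on this event, since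
    elsewhere later rewards of arm k may be read; hence the substitute [Y], which agrees with them
    there. *)
Lemma measurable_history n (a : n.-tuple 'I_K) :
  (n <= N)%N -> (count_mem k a <= m)%N ->
  measurable ([set w | (hist w n).1 = a] : set F) /\
  exists2 Y : F -> n.-tuple R, measurable_fun setT Y &
    forall w, (hist w n).1 = a -> (hist w n).2 = Y w.
Proof.
elim: n a => [a _ _|n IH a nN].
  split.
    rewrite (_ : [set _ | _] = setT)//; apply/seteqP; split => // w _ /=.
    by rewrite [a]tuple0; exact: val_inj.
  by exists (fun=> [tuple]) => //; exact: measurable_cst.
have [a' [x ->]] : exists a' : n.-tuple 'I_K, exists x, a = [tuple of rcons a' x].
  case: a => s; case/lastP: s => [//|s x] hs.
  have hs' : size s == n by move: hs; rewrite size_rcons eqSS.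
  by exists (Tuple hs'), x; apply: val_inj.
move=> km; have {}km : (count_mem k a' + (x == k) <= m)%N.
  by move: km; rewrite /= -cats1 count_cat /= addn0.
have [mE [Y mY YE]] := IH a' (ltnW nN) (leq_trans (leq_addr _ _) km).
have histS w : hist w n.+1 = ([tuple of rcons (hist w n).1
      (alg_choice (hist w n).1 (rand w) (hist w n).2)],
    [tuple of rcons (hist w n).2
      (reward (alg_choice (hist w n).1 (rand w) (hist w n).2)
        (count_mem (alg_choice (hist w n).1 (rand w) (hist w n).2) (hist w n).1) w)]).
  by rewrite /=; case: (history _ _ _).
have rconsE w : (hist w n.+1).1 = [tuple of rcons a' x] ->
    (hist w n).1 = a' /\ alg_choice a' (rand w) (Y w) = x.
  rewrite histS => /(congr1 val)/= /rcons_inj[ea <-].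
  have {}ea : (hist w n).1 = a' by exact: val_inj.
  by rewrite -(YE _ ea) ea.
split.
  have -> : [set w | (hist w n.+1).1 = [tuple of rcons a' x]] =
      [set w | (hist w n).1 = a'] `&`
      (fun w => (rand (b := Q) w, Y w)) @^-1` [set p | alg_choice a' p.1 p.2 = x].
    apply/seteqP; split => w /=; first exact: rconsE.
    move=> [ea ex]; rewrite -[LHS]/((hist w n.+1).1) histS /=.
    by apply: val_inj => /=; rewrite ea (YE _ ea) ex.
  apply: measurableI => //; rewrite -[X in measurable X]setTI.
  apply: (measurable_fun_pair measurable_rand_past mY) => //.
  exact: alg_choice_measurable.
have mX : measurable_fun setT (reward (b := Q) x (count_mem x a') : F -> R).
  apply: measurable_reward_past.
    by rewrite (leq_ltn_trans (count_size _ _))// size_tuple.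
  by move=> /eqP xk; move: km; rewrite xk eqxx addn1.
exists (fun w => [tuple of rcons (Y w) (reward x (count_mem x a') w)]); last first.
  move=> w /[dup] /rconsE[ea ex] _; rewrite histS /=.
  by apply: val_inj => /=; rewrite (YE _ ea) ea ex.
apply/measurable_fun_tnthP => i.
have [iN|iN] := ltnP i n.
  have -> : (@tnth n.+1 R ^~ i \o
      (fun w => [tuple of rcons (Y w) (reward x (count_mem x a') w)])) =
      (@tnth n R ^~ (Ordinal iN)) \o Y.
    apply/funext => w /=; rewrite !(tnth_nth 0) /= nth_rcons size_tuple.
    by rewrite iN.
  by apply: measurableT_comp => //; exact: measurable_tnth.
have -> : (@tnth n.+1 R ^~ i \o
    (fun w => [tuple of rcons (Y w) (reward x (count_mem x a') w)])) =
    reward x (count_mem x a').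
  apply/funext => w /=; rewrite (tnth_nth 0) /= nth_rcons size_tuple.
  have -> : (i : nat) = n by apply/eqP; rewrite eqn_leq iN -ltnS ltn_ord.
  by rewrite ltnn eqxx.
exact: mX.
Qed.

End stopping_time.

(** The stopping-time property, with time counted in draws from arm k: a run with exactly [t] such
    draws reads no further reward of that arm. *)
Lemma num_draws_eq_past (R : realType) (K : nat) (A : algorithm R K)
    (Q : bandit_model A) N k t :
  <<s rects (Q := Q) N k t >> [set w | num_draws N k w = t].
Proof.
pose a_ (a : N.-tuple 'I_K) : set (outcome Q) :=
  [set w | (history (rand w) (fun i j => reward i j w) N).1 = a].
have -> : [set w | num_draws N k w = t] =
    \bigcup_(a in [set a : N.-tuple 'I_K | count_mem k a = t]) a_ a.
  apply/seteqP; split => w /=; last by move=> [a <- aw]; rewrite /num_draws aw.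
  by move=> wt; exists (history (rand w) (fun i j => reward i j w) N).1.
apply: (@fin_bigcup_measurable _ (g_sigma_algebraType (rects (Q := Q) N k t))) => //.
move=> a /= at_.
by have [] := @measurable_history R K A Q N k t N a (leqnn _); rewrite ?at_.
Qed.

(** * The information inequality *)

Section discrete_index.
Context d (T : measurableType d) (R : realType).
Variables (tau : T -> nat) (mtau : forall t, measurable [set w | tau w = t]).

Lemma measurable_fun_index d' (U : measurableType d') (g : nat -> T -> U) :
  (forall t, measurable_fun setT (g t)) ->
  measurable_fun setT (fun w => g (tau w) w).
Proof.
move=> mg _ Y mY; rewrite setTI.
have -> : (fun w => g (tau w) w) @^-1` Y =
    \bigcup_t ([set w | tau w = t] `&` g t @^-1` Y).
  apply/seteqP; split => w /=; first by move=> gY; exists (tau w).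
  by move=> [t _ [/= <-]].
apply: bigcupT_measurable => t; apply: measurableI => //.
by rewrite -[X in measurable X]setTI; exact: mg.
Qed.

Lemma ge0_integral_index (mu : {measure set T -> \bar R}) N (g : nat -> T -> R) :
  (forall w, (tau w <= N)%N) ->
  (forall t, measurable_fun setT (g t)) -> (forall w, 0 <= g (tau w) w) ->
  (\int[mu]_w (g (tau w) w)%:E =
   \sum_(t < N.+1) \int[mu]_(w in [set w | tau w = t]) (g t w)%:E)%E.
Proof.
move=> tauN mg g0.
under [RHS]eq_bigr do rewrite integral_mkcond.
rewrite -ge0_integral_sum//; first last.
- by move=> t w _; rewrite patchE; case: ifPn => //; rewrite inE lee_fin => /= <-.
- move=> t; apply/(measurable_restrictT _ _).1 => //.
  by apply/measurable_EFinP; exact: measurable_funTS.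
apply: eq_integral => w _.
rewrite (bigD1 (Ordinal (tauN w : (tau w < N.+1)%N)))//= patchE ifT ?inE//.
rewrite big1 ?adde0// => t tw; rewrite patchE ifF//.
apply/negbTE/negP; rewrite inE /= => wt; move: tw.
by rewrite -val_eqE /= wt eqxx.
Qed.

End discrete_index.

Section divergence.
Context (R : realType) (K : nat) (A : algorithm R K) (Q : bandit_model A).
Variables (N : nat) (k : 'I_K) (theta theta' : params R K) (d : R).
Hypothesis mean_other : forall i, i != k -> mean theta' i = mean theta i.
Hypothesis sd_other : forall i, i != k -> sd theta' i = sd theta i.
Hypothesis mean_k : mean theta' k = mean theta k + d.
Hypothesis sd_k : sd theta' k = Num.sqrt (sd theta k ^+ 2 + d ^+ 2).
Hypothesis N0 : (0 < N)%N.

Let X (j : nat) : outcome Q -> R := reward k j.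
Let P := prob Q theta.
Let P' := prob Q theta'.
Let q (x : R) : R := llr_gap (mean theta k) (sd theta k) d x.
Let b : R := llr_max (sd theta k) d.
Let T (w : outcome Q) : nat := num_draws N k w.
(** The proportion of draws given to the other arms. Its mean is small under theta', where arm k is
    optimal, and close to 1 under theta. *)
Let share (t : nat) : R := 1 - t%:R / N%:R.

Lemma num_draws_le w : (T w <= N)%N.
Proof. by rewrite (leq_trans (count_size _ _))// size_tuple. Qed.

Lemma measurable_num_draws_eq t : measurable [set w | T w = t].
Proof. exact: g_rects_measurable (@num_draws_eq_past _ _ _ Q N k t). Qed.

Lemma num_draws_gt_past j :
  <<s rects (Q := Q) N k j >> [set w | (j < T w)%N].
Proof.
have -> : [set w | (j < T w)%N] =
    ~` (\bigcup_(t in [set t | (t <= j)%N]) [set w | T w = t]).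
  apply/seteqP; split => w /=.
    by move=> jT [t /= tj Tt]; move: jT; rewrite Tt ltnNge tj.
  by rewrite ltnNge => Tj; apply/negP => jT; apply: Tj; exists (T w).
apply: (@measurableC _ (g_sigma_algebraType (rects (Q := Q) N k j))).
apply: (@bigcup_measurable _ (g_sigma_algebraType (rects (Q := Q) N k j))) => t /= tj.
exact: sub_g_rects tj _ (@num_draws_eq_past _ _ _ Q N k t).
Qed.

Lemma measurable_num_draws_gt j : measurable [set w | (j < T w)%N].
Proof. exact: g_rects_measurable (@num_draws_gt_past j). Qed.

Lemma share_ge0 w : 0 <= share (T w).
Proof. by rewrite subr_ge0 ler_pdivrMr ?ltr0n// mul1r ler_nat num_draws_le. Qed.

Lemma llr_max_ge : 2^-1 <= b.
Proof.
rewrite lerDr mulr_ge0// ln_ge0// lerDl; exact: sqr_ge0.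
Qed.

Lemma integral_num_drawsE (mu : {measure set (outcome Q) -> \bar R}) :
  (\int[mu]_w (T w)%:R%:E = \sum_(j < N) mu [set w | (j < T w)%N])%E.
Proof.
under [RHS]eq_bigr => j _.
  rewrite -[mu _]mul1e -integral_cst; last exact: measurable_num_draws_gt.
  rewrite integral_mkcond; over.
rewrite -ge0_integral_sum//; first last.
- by move=> t w _; rewrite patchE; case: ifP; rewrite // lee_fin.
- move=> t; apply/(measurable_restrictT _ _).1; first exact: measurable_num_draws_gt.
  exact: measurable_cst.
apply: eq_integral => w _.
under eq_bigr do rewrite patchE mem_setE.
rewrite -big_mkcond/=.
rewrite (_ : \sum_(i < N | (i < T w)%N) cst 1%E w = \sum_(i < T w) 1%E)%E; last first.
  by rewrite (big_ord_widen N (fun=> 1%E)) ?num_draws_le.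
by rewrite sumEFin sumr_const card_ord.
Qed.

Lemma integral_num_draws_fin (mu : probability (outcome Q) R) :
  (\int[mu]_w (T w)%:R%:E)%E \is a fin_num.
Proof.
rewrite integral_num_drawsE sum_fin_num; apply/allP => x /mapP[j _ ->].
exact: fin_num_measure (measurable_num_draws_gt j).
Qed.

(* Wald's identity: whether the (j+1)-st reward of arm k is collected is
   determined by the randomization and the rewards preceding it. *)
Lemma integral_stopped_llr_gap :
  (\int[P]_w (\sum_(j < N) if (j < T w)%N then q (X j w) else 0)%:E =
   \int[normal_prob (mean theta k) (sd theta k)]_x (q x)%:E *
   \int[P]_w (T w)%:R%:E)%E.
Proof.
have I0 : (0 <= \int[normal_prob (mean theta k) (sd theta k)]_x (q x)%:E)%E.
  by apply: integral_ge0 => x _; rewrite lee_fin llr_gap_ge0.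
rewrite integral_num_drawsE ge0_sume_distrr//.
have mqX j : measurable_fun setT (fun w => (q (X j w))%:E).
  apply/measurable_EFinP; apply: measurableT_comp; first exact: measurable_llr_gap.
  exact: (@reward_measurable _ _ _ Q).
transitivity (\int[P]_w \sum_(j < N)
    (((fun w => (q (X j w))%:E) \_ [set w | (j < T w)%N]) w))%E.
  apply: eq_integral => w _; rewrite -sumEFin; apply: eq_bigr => j _.
  rewrite patchE; case: ifP => jT; first by rewrite mem_set.
  by rewrite memNset//= jT.
rewrite ge0_integral_sum//; first last.
- by move=> t w _; rewrite patchE; case: ifP; rewrite // lee_fin llr_gap_ge0.
- move=> t; apply/(measurable_restrictT _ _).1; first exact: measurable_num_draws_gt.
  exact: measurable_funTS.
apply: eq_bigr => j _; rewrite -integral_mkcond.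
have p0 : 0 <= fine (P [set w | (j < T w)%N]) by rewrite fine_ge0.
have pE : ((fine (P [set w | (j < T w)%N]))%:E = P [set w | (j < T w)%N])%E.
  by rewrite fineK// fin_num_measure//; exact: measurable_num_draws_gt.
rewrite (@ge0_integral_indep _ _ _ _ _ P
  (normal_prob (mean theta k) (sd theta k)) (X j) _ (NngNum p0)
  (fun x => (q x)%:E))/=.
- by rewrite pE muleC.
- exact: (@reward_measurable _ _ _ Q).
- exact: measurable_num_draws_gt.
- by move=> B mB; rewrite pE; exact: reward_indep (@num_draws_gt_past j) mB.
- by apply/measurable_EFinP; exact: measurable_llr_gap.
- by move=> x; rewrite lee_fin llr_gap_ge0.
Qed.

(** The change of measure at the random time [T]: on each event [T w = t] the weight is constant and
    [prob_tilt] applies with [m = t]. *)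
Lemma integral_tilt_weight (c : {nonneg R}) :
  (\int[P]_w (tilt k theta d (T w) w * (1 + c%:num * share (T w)))%:E =
   \int[P']_w (1 + c%:num * share (T w))%:E)%E.
Proof.
have h0 w : 0 <= 1 + c%:num * share (T w) by rewrite addr_ge0// mulr_ge0// share_ge0.
rewrite (@ge0_integral_index _ _ _ T measurable_num_draws_eq P N
   (fun t w => tilt k theta d t w * (1 + c%:num * share t)))//; first last.
- by move=> w; rewrite mulr_ge0// expR_ge0.
- by move=> t; apply: measurable_funM => //; exact: measurable_tilt.
- exact: num_draws_le.
rewrite (@ge0_integral_index _ _ _ T measurable_num_draws_eq P' N
   (fun t w => (1 + c%:num * share t)))//; first last.
- exact: num_draws_le.
apply: eq_bigr => t _; rewrite integral_cst; last exact: measurable_num_draws_eq.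
under eq_integral do rewrite EFinM muleC.
rewrite ge0_integralZl_EFin//.
- rewrite -(prob_tilt mean_other sd_other mean_k sd_k _
    (@num_draws_eq_past _ _ _ Q N k t))//.
  by rewrite -ltnS.
- exact: measurable_num_draws_eq.
- by move=> w _; rewrite lee_fin expR_ge0.
- by apply/measurable_EFinP/measurable_funTS; exact: measurable_tilt.
- rewrite addr_ge0// mulr_ge0// subr_ge0 ler_pdivrMr ?ltr0n// mul1r ler_nat.
  by rewrite -ltnS.
Qed.

(** The variational inequality before integration. The terms are distributed so that, for [c >= 0],
    all of them are nonnegative on both sides. *)
Lemma tilt_weight_ge c w :
  1 + c * share (T w) + \sum_(j < N) (if (j < T w)%N then q (X j w) else 0) <=
  tilt k theta d (T w) w * (1 + expR c * share (T w)) + b * (T w)%:R.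
Proof.
set S := \sum_(j < N) _.
have tE : tilt k theta d (T w) w = expR (S - b * (T w)%:R).
  rewrite /tilt; congr expR; rewrite sumrB; congr (_ - _); last first.
    by rewrite big_const_ord iter_addr_0 mulr_natr.
  by rewrite (big_ord_widen N (fun j => q (X j w))) ?num_draws_le// big_mkcond.
rewrite tE; set y := S - b * (T w)%:R.
(* Use 1 + z <= e^z at z = y + c with weight [share] and at z = y with weight
   [1 - share]. *)
have f0 := share_ge0 w.
have f1 : 0 <= 1 - share (T w) by rewrite subKr divr_ge0.
have h1 := ler_wpM2l f0 (expR_ge1Dx (y + c)).
have h2 := ler_wpM2l f1 (expR_ge1Dx y).
have h3 : 0 <= share (T w) * expR y by rewrite mulr_ge0// expR_ge0.
by move: h1 h2 h3; rewrite expRD /y; lra.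
Qed.

Lemma measurable_num_draws_fun (g : nat -> R) :
  measurable_fun setT (fun w => (g (T w))%:E).
Proof.
exact: (measurable_fun_index measurable_num_draws_eq
  (fun t => @measurable_cst _ _ _ _ setT (g t)%:E)).
Qed.

(** Integrating [tilt_weight_ge], the stopped sum contributes at least half the mean of [T] by
    Wald's identity, which cancels the 1/2 in [llr_max] and leaves [info]. *)
Lemma divergence_bound (c : R) : 0 <= c ->
  ((expR c)%:E * \int[P']_w (share (T w))%:E <= 1)%E ->
  (c%:E * \int[P]_w (share (T w))%:E <=
   1 + (info (d / sd theta k))%:E * \int[P]_w (T w)%:R%:E)%E.
Proof.
move=> c0 hc.
pose S w := \sum_(j < N) (if (j < T w)%N then q (X j w) else 0).
have int1 (mu : probability (outcome Q) R) : (\int[mu]_w 1 = 1)%E.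
  by rewrite integral_cst// mul1e; exact: probability_setT.
have mshare := measurable_num_draws_fun share.
have share0 w : (0 <= (share (T w))%:E)%E by rewrite lee_fin share_ge0.
have intshare (mu : probability (outcome Q) R) a : 0 <= a ->
    (\int[mu]_w (1 + a * share (T w))%:E = 1 + a%:E * \int[mu]_w (share (T w))%:E)%E.
  move=> a0; rewrite -ge0_integralZl_EFin// -[X in (X + _)%E](int1 mu) -ge0_integralD//.
  - by move=> w _; rewrite mule_ge0// lee_fin.
  - exact: measurable_funeM.
have S0 w : 0 <= S w by apply: sumr_ge0 => j _; case: ifP => // _; exact: llr_gap_ge0.
have mS : measurable_fun setT (fun w => (S w)%:E).
  apply/measurable_EFinP; apply: measurable_sum => j.
  apply: (measurable_fun_index measurable_num_draws_eq
    (g := fun t w => if (j < t)%N then q (X j w) else 0)) => t.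
  case: ltnP => // _; apply: measurableT_comp; first exact: measurable_llr_gap.
  exact: (@reward_measurable _ _ _ Q).
have mT := measurable_num_draws_fun (fun t => t%:R).
have mA : measurable_fun setT (fun w =>
    (tilt k theta d (T w) w * (1 + expR c * share (T w)))%:E).
  apply/measurable_EFinP.
  apply: (measurable_fun_index measurable_num_draws_eq
    (g := fun t w => tilt k theta d t w * (1 + expR c * share t))) => t.
  by apply: measurable_funM => //; exact: measurable_tilt.
have A0 w : 0 <= tilt k theta d (T w) w * (1 + expR c * share (T w)).
  by rewrite mulr_ge0 ?expR_ge0// addr_ge0// mulr_ge0 ?expR_ge0 ?share_ge0.
have b0 : 0 <= b by apply: le_trans llr_max_ge; rewrite invr_ge0.
have m1 : measurable_fun setT (fun w => (1 + c * share (T w))%:E).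
  exact: (measurable_num_draws_fun (fun t => 1 + c * share t)).
have p1 w : (0 <= (1 + c * share (T w))%:E)%E.
  by rewrite lee_fin addr_ge0// mulr_ge0// share_ge0.
have : (\int[P]_w ((1 + c * share (T w))%:E + (S w)%:E) <=
        \int[P]_w ((tilt k theta d (T w) w * (1 + expR c * share (T w)))%:E +
          b%:E * (T w)%:R%:E))%E.
  apply: ge0_le_integral => //.
  - by move=> w _; rewrite adde_ge0// lee_fin.
  - exact: emeasurable_funD.
  - by apply: emeasurable_funD => //; exact: measurable_funeM.
  - by move=> w _; rewrite -EFinM -!EFinD lee_fin; exact: tilt_weight_ge.
rewrite ge0_integralD//; last by move=> w _; rewrite lee_fin.
rewrite (intshare P c c0) integral_stopped_llr_gap.
rewrite ge0_integralD//; last 3 first.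
- by move=> w _; rewrite lee_fin.
- by move=> w _; rewrite -EFinM lee_fin mulr_ge0.
- exact: measurable_funeM.
rewrite ge0_integralZl_EFin// (integral_tilt_weight (NngNum (expR_ge0 c)))/=.
rewrite (intshare P' _ (expR_ge0 c)).
(* Finiteness of the mean of [T] is what permits this cancellation. *)
have ETfin := integral_num_draws_fin P; move: ETfin.
have : (0 <= \int[P]_w (T w)%:R%:E)%E by apply: integral_ge0 => w _; rewrite lee_fin.
case: (\int[P]_w (T w)%:R%:E)%E => // r; rewrite lee_fin => r0 _.
have : (\int[P]_w (share (T w))%:E <= 1)%E.
  rewrite -[leRHS](int1 P); apply: ge0_le_integral => // w _.
  by rewrite lee_fin lerBlDr lerDl divr_ge0.
have : (0 <= \int[P]_w (share (T w))%:E)%E by apply: integral_ge0.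
case: (\int[P]_w (share (T w))%:E)%E => // f; rewrite !lee_fin => f0 f1 h.
have {}h : (1 + c%:E * f%:E + (2^-1)%:E * r%:E <= 1 + 1 + b%:E * r%:E)%E.
  apply: (le_trans (leeD2l _ (lee_wpmul2r _ (integral_llr_gap_ge _ _ (sd_gt0 theta k))))).
    by rewrite lee_fin.
  by apply: (le_trans h); rewrite leeD2r// leeD2l.
move: h; rewrite -!EFinM -!EFinD !lee_fin /b /llr_max; lra.
Qed.
End divergence.

(** * Making an inferior arm optimal *)

Section params_theory.
Context (R : realType) (K : nat).
Implicit Types (theta : params R K) (k i : 'I_K).

Lemma best_mean_ge theta i : mean theta i <= best_mean theta.
Proof.
apply: ub_le_sup; last by exists i.
exists (\sum_j `|mean theta j|) => _ [j _ <-].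
rewrite (bigD1 j)//= (le_trans (ler_norm _))// lerDl.
by apply: sumr_ge0.
Qed.

Lemma best_mean_le theta i (x : R) : (forall j, mean theta j <= x) ->
  best_mean theta <= x.
Proof. by move=> mx; apply: ge_sup; [exists (mean theta i), i | move=> _ [j _ <-]]. Qed.

Lemma best_mean_eq theta k : (forall i, mean theta i <= mean theta k) ->
  best_mean theta = mean theta k.
Proof. by move=> h; apply/eqP; rewrite eq_le best_mean_ge (best_mean_le k). Qed.

Lemma info_gt0 (z : R) : 0 < z -> 0 < info z.
Proof. by move=> z0; rewrite mulr_gt0 ?invr_gt0// ln_gt0// ltrDl exprn_gt0. Qed.

Lemma le_info (y z : R) : 0 <= y -> y <= z -> info y <= info z.
Proof.
move=> y0 yz; rewrite /info ler_pM2l ?invr_gt0// ler_ln ?posrE ?ltr_pwDl ?sqr_ge0//.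
by rewrite lerD2l lerXn2r ?nnegrE// (le_trans y0).
Qed.

(* ln (1 + b v) <= ln (1 + v) + (b - 1) v / (1 + v), and v / (1 + v) <= ln (1 + v). *)
Lemma info_scale (a z : R) : 1 <= a -> info (a * z) <= a ^+ 2 * info z.
Proof.
move=> a1; rewrite /info exprMn [leRHS]mulrCA ler_pM2l ?invr_gt0//.
have : 1 <= a ^+ 2 by rewrite exprn_ege1.
move: (sqr_ge0 z) (a ^+ 2); move: (z ^+ 2) => v v0 c c1.
have v1 : 0 < 1 + v by rewrite ltr_pwDl.
have h1 : v / (1 + v) <= ln (1 + v).
  have := @le_ln1Dx R (- (v / (1 + v))).
  have -> : 1 + - (v / (1 + v)) = (1 + v)^-1 by field; rewrite gt_eqF.
  rewrite lnV ?posrE// lerN2; apply.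
  by rewrite ltrN2 ltr_pdivrMr// mul1r ltrDr.
have h2 : ln (1 + c * v) <= ln (1 + v) + (c - 1) * (v / (1 + v)).
  have cv : 0 <= (c - 1) * (v / (1 + v)) by rewrite mulr_ge0 ?subr_ge0// divr_ge0// ltW.
  have -> : 1 + c * v = (1 + v) * (1 + (c - 1) * (v / (1 + v))).
    by field; rewrite gt_eqF.
  rewrite lnM ?posrE ?ltr_pwDl// lerD2l le_ln1Dx//.
  by apply: lt_le_trans cv; rewrite oppr_lt0.
apply: (le_trans h2); have := ler_wpM2l _ h1 => /(_ (c - 1)).
by rewrite subr_ge0 => /(_ c1); lra.
Qed.

Lemma shift_sd_gt0 theta k (d : R) i :
  0 < (if i == k then Num.sqrt (sd theta k ^+ 2 + d ^+ 2) else sd theta i).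
Proof.
case: ifP => _; last exact: sd_gt0.
by rewrite sqrtr_gt0 ltr_pwDl ?sqr_ge0// exprn_gt0// sd_gt0.
Qed.

Definition shift_arm theta k (d : R) : params R K :=
  Params (fun i => if i == k then mean theta k + d else mean theta i)
         (shift_sd_gt0 theta k d).

Section shift_arm_Theta2.
Variables (theta : params R K) (k : 'I_K) (Delta eta : R).
Hypotheses (D0 : 0 < Delta) (eta0 : 0 < eta) (eta1 : eta <= 1).
Hypotheses (thetaD : Theta2 Delta theta) (kinf : mean theta k < best_mean theta).

Let d := best_mean theta - mean theta k + eta * Delta.
Let theta' := shift_arm theta k d.

Let eD0 : 0 < eta * Delta. Proof. by rewrite mulr_gt0. Qed.

Lemma mean_shift_arm : mean theta' k = best_mean theta + eta * Delta.
Proof. by rewrite /= eqxx /d; ring. Qed.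

Lemma best_mean_shift_arm : best_mean theta' = best_mean theta + eta * Delta.
Proof.
rewrite -mean_shift_arm; apply: best_mean_eq => i; rewrite mean_shift_arm /=.
case: ifP => _; first by rewrite /d; lra.
by rewrite (le_trans (best_mean_ge _ _))// lerDl ltW.
Qed.

Lemma gap_shift_arm i : i != k -> eta * Delta <= best_mean theta' - mean theta' i.
Proof.
move=> ik; rewrite best_mean_shift_arm /= (negbTE ik).
by have := best_mean_ge theta i; lra.
Qed.

Lemma num_inferior_shift_arm : num_inferior theta' = K.-1.
Proof.
rewrite -[K in RHS]card_ord -(cardC1 k); apply: eq_card => i.
transitivity (mean theta' i < best_mean theta'); first by apply/idP/idP; rewrite inE.
rewrite inE; have [->|ik] := eqVneq i k.
  by rewrite mean_shift_arm best_mean_shift_arm ltxx.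
by rewrite -subr_gt0 (lt_le_trans eD0 (gap_shift_arm ik)).
Qed.

(** The 4 covers the new standard deviation: [d <= 3 / Delta] and [sd theta k <= 1 / Delta] give at
    most [4 / Delta]. It also covers the count of inferior arms: two distinct means force [K >= 2],
    so [K - 1 >= K / 2]. *)
Lemma shift_arm_Theta2 : Theta2 (eta * Delta / 4) theta'.
Proof.
have [gapD meanD sdD numD] := thetaD.
have Dp := D0; have ep := eta0; have ep1 := eta1; have eDp := eD0.
have /andP[sd1 sd2] := sdD k.
have DV : Delta * Delta^-1 = 1 by rewrite divff ?gt_eqF.
have DV0 : 0 < Delta^-1 by rewrite invr_gt0.
have DDV : Delta <= Delta^-1 by exact: le_trans sd2.
have D1 : Delta <= 1 by nra.
have inv4 : (eta * Delta / 4)^-1 = 4 * eta^-1 * Delta^-1.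
  by rewrite !invfM invrK; ring.
have etaV : 1 <= eta^-1 by rewrite invf_ge1.
have h4 : 4 * Delta^-1 <= 4 * eta^-1 * Delta^-1 by rewrite -mulrA ler_pM2l// ler_peMl// ltW.
have eD : eta * Delta <= Delta by rewrite ler_piMl// ltW.
have h4' : eta * Delta / 4 <= Delta.
  by lra.
have bl : - Delta^-1 <= best_mean theta.
  by have := best_mean_ge theta k; have := meanD k; rewrite ler_norml => /andP[]; lra.
have bu : best_mean theta <= Delta^-1.
  by apply: (best_mean_le k) => j; have := meanD j; rewrite ler_norml => /andP[].
split.
- move=> i; have [->|ik] := eqVneq i k.
    by rewrite mean_shift_arm best_mean_shift_arm ltxx.
  by move=> _; have := gap_shift_arm ik; lra.
- move=> i; rewrite inv4; have [->|ik] := eqVneq i k.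
    by rewrite mean_shift_arm ler_norml; lra.
  by rewrite /= (negbTE ik); apply: le_trans (meanD i) _; lra.
- move=> i; rewrite inv4 /=; case: ifP => _; last by have := sdD i; lra.
  have dk0 : 0 <= d by rewrite /d; have := best_mean_ge theta k; lra.
  have dk1 : d <= 3 * Delta^-1.
    by rewrite /d; have := meanD k; rewrite ler_norml => /andP[]; lra.
  have s0 := sd_gt0 theta k.
  apply/andP; split.
    apply: (@le_trans _ _ (sd theta k)); first by lra.
    rewrite -[leLHS]gtr0_norm// -sqrtr_sqr ler_sqrt ?lerDl ?sqr_ge0//.
    by rewrite addr_ge0 ?sqr_ge0.
  apply: (@le_trans _ _ (4 * Delta^-1)); last by [].
  have h : 0 <= 4 * Delta^-1 by lra.
  rewrite -[leRHS]ger0_norm// -sqrtr_sqr ler_sqrt ?sqr_ge0//.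
  by nra.
- rewrite num_inferior_shift_arm.
  have K2 : (2 <= K)%N.
    rewrite ltnNge; apply/negP => K1; move: kinf.
    rewrite (best_mean_eq (k := k)) ?ltxx// => i.
    suff -> : i = k by [].
    have ord0E (j : 'I_K) : (j : nat) = 0%N.
      by apply/eqP; rewrite -leqn0 -ltnS (leq_trans (ltn_ord j)).
    by apply: val_inj; rewrite /= !ord0E.
  have K2R : 2 <= K%:R :> R by rewrite ler_nat.
  rewrite -subn1 natrB ?(ltnW K2)//.
  by nra.
Qed.

End shift_arm_Theta2.
End params_theory.

(** * Lower bounds on the regret *)

Lemma sum_count_mem (T : finType) (s : seq T) :
  (\sum_(i : T) count_mem i s)%N = size s.
Proof.
elim: s => [|x s IH]; first by rewrite big1.
rewrite /= big_split /= IH (bigD1 x)//= eqxx big1 ?addn0// => i ix.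
by rewrite eq_sym (negbTE ix).
Qed.

Section regret.
Context (R : realType) (K : nat) (A : algorithm R K) (Q : bandit_model A).
Variable N : nat.
Implicit Types (theta : params R K) (k i : 'I_K).

Let ET theta k : \bar R := (\int[prob Q theta]_w (num_draws N k w)%:R%:E)%E.

Lemma mean_draws_ge0 theta k : (0 <= ET theta k)%E.
Proof. by apply: integral_ge0 => w _; rewrite lee_fin. Qed.

Lemma regretE theta : regret Q N theta =
  (\sum_(k < K) (best_mean theta - mean theta k)%:E * ET theta k)%E.
Proof. by apply: eq_bigr => k _; rewrite unlock. Qed.

Lemma gap_ge0 theta k : (0 <= (best_mean theta - mean theta k)%:E)%E.
Proof. by rewrite lee_fin subr_ge0 best_mean_ge. Qed.

Lemma regret_ge_arm theta k :
  ((best_mean theta - mean theta k)%:E * ET theta k <= regret Q N theta)%E.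
Proof.
rewrite regretE (bigD1 k)//= leeDl// sume_ge0// => i _.
by apply: mule_ge0; [exact: gap_ge0 | exact: mean_draws_ge0].
Qed.

(** The draws add up to [N], so [N] times the integrand counts the draws from arms other than [k],
    each costing at least [g]. *)
Lemma regret_ge_others theta k (g : R) : (0 < N)%N -> 0 <= g ->
  (forall i, i != k -> g <= best_mean theta - mean theta i) ->
  ((g * N%:R)%:E * \int[prob Q theta]_w (1 - (num_draws N k w)%:R / N%:R)%:E
    <= regret Q N theta)%E.
Proof.
move=> N0 g0 gap.
have mT i : measurable_fun setT (fun w : outcome Q => (num_draws N i w)%:R%:E : \bar R).
  exact: (@measurable_num_draws_fun _ _ _ Q N i (fun t => t%:R)).
have sE w : ((g * N%:R * (1 - (num_draws N k w)%:R / N%:R))%:E =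
    \sum_(i < K | i != k) g%:E * (num_draws N i w)%:R%:E)%E.
  have -> : (g * N%:R * (1 - (num_draws N k w)%:R / N%:R) =
      g * (N%:R - (num_draws N k w)%:R)).
    by field; rewrite pnatr_eq0 -lt0n.
  under eq_bigr do rewrite -EFinM.
  rewrite sumEFin -mulr_sumr; congr (_ * _)%:E; apply/eqP; rewrite subr_eq.
  rewrite -natr_sum -natrD; apply/eqP; congr (_%:R).
  rewrite addnC -(bigD1 k (P := xpredT))//=.
  by rewrite /num_draws sum_count_mem size_tuple.
rewrite -ge0_integralZl_EFin//; last 3 first.
- by move=> w _; rewrite lee_fin; exact: share_ge0.
- exact: (@measurable_num_draws_fun _ _ _ Q N k (fun t => 1 - t%:R / N%:R)).
- by rewrite mulr_ge0.
pose others := [seq i <- index_enum 'I_K | i != k].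
rewrite (eq_integral (fun w => \sum_(i <- others) g%:E * (num_draws N i w)%:R%:E)%E);
  last by move=> w _; rewrite -EFinM sE big_filter.
rewrite ge0_integral_sum//; last 2 first.
- by move=> i; exact: measurable_funeM.
- by move=> i w _; rewrite -EFinM lee_fin mulr_ge0.
rewrite big_filter regretE [leRHS](bigD1 k)//= -[leLHS]add0e leeD//.
  by apply: mule_ge0; [exact: gap_ge0 | exact: mean_draws_ge0].
apply: lee_sum => i ik; rewrite ge0_integralZl_EFin//.
by rewrite lee_wpmul2r ?mean_draws_ge0// lee_fin gap.
Qed.

(** The condition on [c] and [rho'] turns the regret bound at the shifted parameter into the
    hypothesis of [divergence_bound]. The regret bound [rho] at [theta] itself gives mean share at
    least [1 - rho / (Delta * N%:R)]. *)
Lemma mean_draws_lower theta k (Delta eta c rho rho' : R) :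
  (0 < N)%N -> 0 < Delta -> 0 < eta -> eta <= 1 -> 0 <= c ->
  Theta2 Delta theta -> mean theta k < best_mean theta ->
  (regret Q N theta <= rho%:E)%E ->
  (forall theta', Theta2 (eta * Delta / 4) theta' -> (regret Q N theta' <= rho'%:E)%E) ->
  expR c * rho' <= eta * Delta * N%:R ->
  ((c * (1 - rho / (Delta * N%:R)) - 1)%:E <=
   ((1 + eta) ^+ 2 * info ((best_mean theta - mean theta k) / sd theta k))%:E *
   ET theta k)%E.
Proof.
move=> N0 D0 eta0 eta1 c0 thD kinf reg reg' crho.
set gap := best_mean theta - mean theta k.
have NR : 0 < N%:R :> R by rewrite ltr0n.
have gapD : Delta <= gap.
  by have [/(_ k kinf) + _ _ _] := thD; rewrite /gap; lra.
pose d := gap + eta * Delta; pose theta' := shift_arm theta k d.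
have eD0 : 0 < eta * Delta by rewrite mulr_gt0.
have other i : i != k -> eta * Delta <= best_mean theta' - mean theta' i.
  by move=> ik; exact: gap_shift_arm.
have thD' : Theta2 (eta * Delta / 4) theta' by exact: shift_arm_Theta2.
have := regret_ge_others N0 (ltW eD0) other.
move=> /le_trans/(_ (reg' _ thD')) => share'.
have := @divergence_bound R K A Q N k theta theta' d _ _ _ _ N0 c c0.
have h1 i : i != k -> mean theta' i = mean theta i by move=> /negbTE /= ->.
have h2 i : i != k -> sd theta' i = sd theta i by move=> /negbTE /= ->.
have h3 : mean theta' k = mean theta k + d by rewrite /= eqxx.
have h4 : sd theta' k = Num.sqrt (sd theta k ^+ 2 + d ^+ 2) by rewrite /= eqxx.
move=> /(_ h1 h2 h3 h4) divb {h1 h2 h3 h4}.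
have s0 := sd_gt0 theta k.
have infod : info (d / sd theta k) <= (1 + eta) ^+ 2 * info (gap / sd theta k).
  apply: le_trans (info_scale _ _); last by rewrite lerDl ltW.
  apply: le_info; first by rewrite divr_ge0 ?(ltW s0)// addr_ge0// ltW// (lt_le_trans D0).
  rewrite mulrA ler_pM2r ?invr_gt0// /d mulrDl mul1r lerD2l.
  by rewrite ler_pM2l.
have {}divb : (c%:E * \int[prob Q theta]_w (1 - (num_draws N k w)%:R / N%:R)%:E <=
    1 + (info (d / sd theta k))%:E * ET theta k)%E.
  apply: divb; move: share'.
  have : (0 <= \int[prob Q theta']_w (1 - (num_draws N k w)%:R / N%:R)%:E)%E.
    by apply: integral_ge0 => w _; rewrite lee_fin; exact: share_ge0.
  have gN : 0 < eta * Delta * N%:R by rewrite mulr_gt0.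
  case: (integral _ _ _) => [f||]//; last by rewrite gt0_muley ?lte_fin// leye_eq.
  rewrite -!EFinM !lee_fin => f0 gf.
  rewrite -(ler_pM2l gN) mulr1 (le_trans _ crho)// mulrCA.
  by rewrite ler_pM2l ?expR_gt0.
have sum1 : (\int[prob Q theta]_w (1 - (num_draws N k w)%:R / N%:R)%:E +
    (N%:R^-1)%:E * ET theta k = 1)%E.
  have mT := @measurable_num_draws_fun _ _ _ Q N k (fun t => t%:R).
  rewrite -ge0_integralZl_EFin//.
  rewrite -ge0_integralD//; first last.
  - exact: measurable_funeM.
  - exact: (@measurable_num_draws_fun _ _ _ Q N k (fun t => 1 - t%:R / N%:R)).
  - by move=> w _; rewrite lee_fin; exact: share_ge0.
  rewrite (eq_integral (cst 1%E)); last first.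
    by move=> w _; rewrite -EFinM -EFinD [N%:R^-1 * _]mulrC subrK.
  by rewrite integral_cst// mul1e; exact: probability_setT.
move: divb sum1 (le_trans (regret_ge_arm theta k) reg).
move: (@integral_num_draws_fin _ _ _ Q N k (prob Q theta)) (mean_draws_ge0 theta k).
rewrite -/gap -/(ET theta k).
case: (ET theta k) => // r.
case: (integral _ _ _) => // f; rewrite -!EFinM -!EFinD !lee_fin.
move=> _ r0 divb [sum1] gr.
have r1 : r / N%:R <= rho / (Delta * N%:R).
  rewrite invfM mulrA ler_pM2r ?invr_gt0// ler_pdivlMr//.
  by apply: le_trans gr; rewrite mulrC ler_wpM2r.
have cf : c * (1 - rho / (Delta * N%:R)) <= c * f by rewrite ler_wpM2l//; lra.
have := ler_wpM2r r0 infod; lra.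
Qed.

(** The lower bound on the number of inferior arms provides a nonzero term; positivity allows the
    final division by [lower_coef theta]. *)
Lemma lower_coef_gt0 theta Delta : (0 < K)%N -> 0 < Delta -> Theta2 Delta theta ->
  0 < lower_coef theta.
Proof.
move=> K0 D0 [_ _ _ numD].
have pos k : mean theta k < best_mean theta ->
    0 < (best_mean theta - mean theta k) /
    info ((best_mean theta - mean theta k) / sd theta k).
  move=> kinf; have gap0 : 0 < best_mean theta - mean theta k by rewrite subr_gt0.
  by rewrite divr_gt0// info_gt0// divr_gt0// sd_gt0.
have /card_gt0P[k] : (0 < num_inferior theta)%N.
  by rewrite -(ltr0n R); apply: lt_le_trans numD; rewrite mulr_gt0// ltr0n.
rewrite inE => kinf.
rewrite /lower_coef (bigD1 k)//= ltr_pwDl ?pos// sumr_ge0// => i /andP[? _].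
by rewrite ltW// pos.
Qed.

Lemma regret_lower theta (Delta eta c rho rho' : R) :
  (0 < N)%N -> 0 < Delta -> 0 < eta -> eta <= 1 -> 0 <= c ->
  Theta2 Delta theta ->
  (regret Q N theta <= rho%:E)%E ->
  (forall theta', Theta2 (eta * Delta / 4) theta' -> (regret Q N theta' <= rho'%:E)%E) ->
  expR c * rho' <= eta * Delta * N%:R ->
  (((c * (1 - rho / (Delta * N%:R)) - 1) / (1 + eta) ^+ 2 * lower_coef theta)%:E
   <= regret Q N theta)%E.
Proof.
move=> N0 D0 eta0 eta1 c0 thD reg reg' crho.
set B := c * _ - 1.
rewrite regretE (bigID (fun k => mean theta k < best_mean theta))/=.
rewrite -[leLHS]adde0 leeD//; last first.
  by apply: sume_ge0 => k _; apply: mule_ge0; [exact: gap_ge0 | exact: mean_draws_ge0].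
rewrite /lower_coef mulr_sumr -sumEFin; apply: lee_sum => k kinf.
have := mean_draws_lower N0 D0 eta0 eta1 c0 thD kinf reg reg' crho.
rewrite -/B; set gap := best_mean theta - mean theta k.
have gap0 : 0 < gap by rewrite subr_gt0.
have I0 : 0 < info (gap / sd theta k) by rewrite info_gt0// divr_gt0// sd_gt0.
have e0 : 0 < (1 + eta) ^+ 2 by rewrite exprn_gt0// addr_gt0.
have := @integral_num_draws_fin _ _ _ Q N k (prob Q theta).
rewrite -/(ET theta k); case: (ET theta k) => // r _.
rewrite -!EFinM !lee_fin => h.
rewrite mulrCA ler_pM2l// -mulrA -invfM ler_pdivrMr; last exact: mulr_gt0.
by rewrite mulrC.
Qed.

End regret.

(** * Asymptotics *)

Section asymptotics.
Context (R : realType).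
Implicit Types (e M : R).

Lemma near_ge_ln M : \forall N \near \oo, M <= ln N%:R :> R.
Proof.
near=> N.
have : expR M <= N%:R by near: N; exact: nbhs_infty_ger.
move=> h; have N0 : 0 < N%:R :> R by exact: lt_le_trans (expR_gt0 M) h.
by rewrite -ler_expR lnK.
Unshelve. all: by end_near. Qed.

Lemma powRE_gt0 (a x : R) : 0 < a -> a `^ x = expR (x * ln a).
Proof. by move=> a0; rewrite /powR gt_eqF. Qed.

Lemma near_ge_powR e M : 0 < e -> \forall N \near \oo, M <= N%:R `^ e :> R.
Proof.
move=> e0; near=> N.
have h : `|M| / e <= ln N%:R by near: N; exact: near_ge_ln.
have N0 : 0 < N%:R :> R.
  by near: N; apply: filterS (nbhs_infty_ger 1) => n; apply: lt_le_trans.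
rewrite powRE_gt0//; apply: (le_trans _ (expR_ge1Dx _)).
move: h; rewrite ler_pdivrMr// mulrC => h.
by apply: (le_trans (ler_norm _)); lra.
Unshelve. all: by end_near. Qed.

Lemma limn_einf_ge (u : nat -> \bar R) (l : R) :
  (forall e, 0 < e -> \forall N \near \oo, ((l - e)%:E <= u N)%E) ->
  (l%:E <= limn_einf u)%E.
Proof.
move=> h; apply/lee_addgt0Pr => e e0; rewrite -leeBlDr// -EFinB.
rewrite limn_einf_lim; apply: lime_ge; first exact: is_cvg_einfs.
have [n0 _ un0] := h _ e0.
exists n0 => // n /= n0n; apply: le_ereal_inf_tmp => _ [m /= nm <-].
by apply: un0 => /=; exact: leq_trans nm.
Qed.

Lemma subpolynomial_scale (Delta : nat -> R) a : 0 < a ->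
  subpolynomial Delta -> subpolynomial (fun K => a * Delta K).
Proof.
move=> a0 [D0 Dcvg DK]; split.
- by move=> K; rewrite mulr_gt0.
- by rewrite -[X in _ --> X](mulr0 a); apply: cvgM => //; exact: cvg_cst.
- move=> e e0; apply/cvgryPge => M.
  have /cvgryPge/(_ (M / a)) := DK e e0; apply: filterS => K.
  by rewrite ler_pdivrMr// mulrC mulrA.
Qed.

(** For growing [K], subpolynomial decay gives [Delta K >= K ^ (- e)], and [K <= N] eventually. For
    fixed [K] both quantities are constants, which powers of [N] overtake. *)
Lemma regime_rates (K : nat -> nat) (zeta : R) (Delta : nat -> R) e :
  arms_regime K zeta -> subpolynomial Delta -> 0 < e ->
  \forall N \near \oo, (K N)%:R <= N%:R `^ (zeta + e) :> R /\
     N%:R `^ (- e) <= Delta (K N).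
Proof.
move=> [[/andP[z0 z1] Koo [s s0 KE]]|[-> [K0 KE]]] [D0 _ DK] e0.
(* The bound [1 - zeta] on the exponent error is what ensures [K N <= N]. *)
- have z10 : 0 < Num.min e (1 - zeta) by rewrite lt_min e0 subr_gt0.
  near=> N.
  have N1 : 1 <= N%:R :> R by near: N; exact: nbhs_infty_ger.
  have N0 : 0 < N%:R :> R by exact: lt_le_trans N1.
  have sN : `|s N| <= Num.min e (1 - zeta).
    by near: N; move/cvgr0Pnorm_le : s0; exact.
  have KN : (K N)%:R = N%:R `^ (zeta + s N) by near: N; exact: KE.
  have [se s1] : s N <= e /\ s N <= 1 - zeta.
    by move: (le_trans (ler_norm _) sN); rewrite le_min => /andP[].
  have : 1 <= Delta (K N) * (K N)%:R `^ e.
    near: N; have /cvgryPge/(_ 1) := DK e e0.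
    exact: Koo.
  split; first by rewrite KN ler_powR// lerD2l.
  rewrite powRN -[leLHS]mul1r ler_pdivrMr ?powR_gt0//.
  apply: (le_trans (y := Delta (K N) * (K N)%:R `^ e)) => //.
  rewrite ler_pM2l// ge0_ler_powR ?nnegrE ?(ltW e0)//.
  by rewrite KN -[leRHS]powRr1 ?(ltW N0)// ler_powR//; lra.
- near=> N; rewrite !KE add0r.
  have N1 : 1 <= N%:R :> R by near: N; exact: nbhs_infty_ger.
  have N0 : 0 < N%:R :> R by exact: lt_le_trans N1.
  split; first by near: N; exact: near_ge_powR.
  rewrite powRN invf_ple ?posrE ?powR_gt0//.
  by near: N; exact: near_ge_powR.
Unshelve. all: by end_near. Qed.

(** Budget for the loss of [9 * e]: 5 are already in [c], one pays for [p], one for the constant 1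
    (at most [e * L]), and two for dividing by [(1 + e) ^+ 2]. *)
Lemma rate_bound (a e delta p L : R) : 0 < e -> 10 * e <= a -> a <= 1 ->
  9 * e <= delta -> 0 < L -> 1 <= e * L -> p <= e ->
  (a - delta) * L <= ((a - 5 * e) * L * (1 - p) - 1) / (1 + e) ^+ 2.
Proof.
move=> e0 ea a1 ed L0 eL pe.
have e2 : 0 < (1 + e) ^+ 2 by rewrite exprn_gt0//; lra.
rewrite ler_pdivlMr//; apply: (le_trans (y := (a - 7 * e) * L)).
  rewrite mulrAC ler_pM2r//.
  apply: (le_trans (y := (a - 9 * e) * (1 + e) ^+ 2)); first by rewrite ler_pM2r//; lra.
  have : (a - 9 * e) * (2 + e) <= 2 by nra.
  by move=> /(ler_wpM2l (ltW e0)); lra.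
have : (a - 5 * e) * L * (1 - e) <= (a - 5 * e) * L * (1 - p).
  by rewrite ler_wpM2l ?mulr_ge0 ?(ltW L0)//; lra.
have : 0 <= (e * (1 - a) + 5 * e ^+ 2) * L.
  by rewrite mulr_ge0 ?(ltW L0)// addr_ge0 ?mulr_ge0 ?sqr_ge0//; lra.
by lra.
Qed.

End asymptotics.

Theorem theorem3 (R : realType) (K : nat -> nat) (zeta : R)
    (A : forall N : nat, algorithm R (K N))
    (Q : forall N : nat, bandit_model (A N)) :
  arms_regime K zeta ->
  uniformly_good Q ->
  forall Delta : nat -> R, subpolynomial Delta ->
  ((1 - zeta)%:E <=
   limn_einf (fun N : nat =>
     ereal_inf [set regret (Q N) N theta *
                    ((lower_coef theta * ln N%:R)^-1)%:E |
                theta in Theta2 (Delta (K N))]))%E.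
Proof.
move=> regime good Delta subD.
pose a := 1 - zeta.
have [a0 a1] : 0 < a /\ a <= 1.
  by rewrite /a; case: regime => [[/andP[]]|[-> _]]; lra.
apply: limn_einf_ge => delta delta0.
(* One small parameter serves as the margin [eta], as the exponent in uniform goodness and as the
   slack in the rates of [K] and [Delta]; 9 is the total loss in [rate_bound]. *)
pose e := Num.min (a / 10) (delta / 9).
have e0 : 0 < e by rewrite lt_min !divr_gt0.
have ea : 10 * e <= a.
  have : e <= a / 10 by rewrite ge_min lexx.
  by lra.
have ed : 9 * e <= delta.
  have : e <= delta / 9 by rewrite ge_min lexx orbT.
  by lra.
have e1 : e <= 1 by lra.
have subD' : subpolynomial (fun k => e * Delta k / 4).
  have := @subpolynomial_scale R Delta (e / 4) _ subD.
  have -> : (fun k => e * Delta k / 4) = (fun k => e / 4 * Delta k).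
    by apply/funext => k; rewrite mulrAC.
  by apply; rewrite divr_gt0.
near=> N.
have [KN DN] : (K N)%:R <= N%:R `^ (zeta + e) /\ N%:R `^ (- e) <= Delta (K N).
  by near: N; exact: regime_rates.
have L1 : e^-1 <= ln N%:R by near: N; exact: near_ge_ln.
have N2 : 2 <= N%:R :> R by near: N; exact: nbhs_infty_ger.
(* Spare powers of [N], to absorb the constant [e] in [crho] and in [p1] respectively. *)
have P2 : e^-1 <= N%:R `^ (2 * e) by near: N; apply: near_ge_powR; rewrite mulr_gt0.
have Pa : e^-1 <= N%:R `^ (a - 3 * e) by near: N; apply: near_ge_powR; lra.
have reg : forall theta, Theta2 (Delta (K N)) theta ->
    (regret (Q N) N theta <= (1 * ((K N)%:R * N%:R `^ e))%:E)%E.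
  near: N; apply: filterS (good _ subD e e0 1 ltr01) => N + theta thD.
  rewrite ge_max => /andP[_]; apply: le_trans.
  by apply: ereal_sup_ubound; exists theta.
have reg' : forall theta, Theta2 (e * Delta (K N) / 4) theta ->
    (regret (Q N) N theta <= (1 * ((K N)%:R * N%:R `^ e))%:E)%E.
  near: N; apply: filterS (good _ subD' e e0 1 ltr01) => N + theta thD.
  rewrite ge_max => /andP[_]; apply: le_trans.
  by apply: ereal_sup_ubound; exists theta.
have {}N0 : 0 < N%:R :> R by lra.
have N0n : (0 < N)%N by rewrite -(ltr0n R).
have D0 : 0 < Delta (K N) by have [+ _ _] := subD; apply.
(* There is at least one arm, because an algorithm names one even on the empty history. *)
have K0 : (0 < K N)%N.
  exact: leq_ltn_trans (leq0n _) (ltn_ord (@alg_choice _ _ (A N) 0 [tuple] point [tuple])).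
apply: le_ereal_inf_tmp => _ [theta thD <-].
have lc0 := lower_coef_gt0 K0 D0 thD.
set L := ln N%:R in L1 *.
have NE : N%:R = expR L by rewrite lnK.
have L0 : 0 < L by apply: lt_le_trans L1; rewrite invr_gt0.
rewrite !powRE_gt0// -/L in KN DN P2 Pa reg reg'.
pose rho := expR ((zeta + 2 * e) * L).
have rhoE : 1 * ((K N)%:R * expR (e * L)) <= rho.
  rewrite mul1r /rho.
  have -> : (zeta + 2 * e) * L = (zeta + e) * L + e * L by ring.
  by rewrite expRD ler_pM2r ?expR_gt0.
have {}reg : (regret (Q N) N theta <= rho%:E)%E.
  by apply: le_trans (reg _ thD) _; rewrite lee_fin.
have {}reg' theta' : Theta2 (e * Delta (K N) / 4) theta' ->
    (regret (Q N) N theta' <= rho%:E)%E.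
  by move=> thD'; apply: le_trans (reg' _ thD') _; rewrite lee_fin.
(* Of the 5, two offset the excess exponent in [rho], one the decay of [Delta], and two give the
   power of [N] that absorbs the factor [e] in [crho]. *)
pose c := (a - 5 * e) * L.
have c0 : 0 <= c by rewrite mulr_ge0 ?(ltW L0)//; lra.
have DN0 : expR ((1 - e) * L) <= Delta (K N) * N%:R.
  have -> : (1 - e) * L = - e * L + L by ring.
  by rewrite expRD NE ler_pM2r ?expR_gt0.
have crho : expR c * rho <= e * Delta (K N) * N%:R.
  rewrite -expRD -mulrA -ler_pdivrMl//.
  have -> : c + (zeta + 2 * e) * L = (1 - e) * L - 2 * e * L by rewrite /c /a; ring.
  apply: le_trans DN0; rewrite expRD mulrCA ler_piMr ?expR_ge0//.
  by rewrite expRN ler_pdivrMr ?expR_gt0// mul1r.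
have p1 : rho / (Delta (K N) * N%:R) <= e.
  rewrite ler_pdivrMr ?mulr_gt0//; apply: le_trans (_ : e * expR ((1 - e) * L) <= _).
    have -> : (1 - e) * L = (zeta + 2 * e) * L + (a - 3 * e) * L by rewrite /a; ring.
    rewrite expRD mulrCA ler_peMr ?expR_ge0//.
    by rewrite -ler_pdivrMl// mulr1.
  by rewrite ler_pM2l.
have := regret_lower N0n D0 e0 e1 c0 thD reg reg' crho.
rewrite lee_pdivlMr ?mulr_gt0// -EFinM; apply: le_trans; rewrite lee_fin.
rewrite mulrCA [leRHS]mulrC ler_pM2l//; apply: rate_bound => //.
by rewrite -ler_pdivrMl// mulr1.
Unshelve. all: by end_near. Qed.
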